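(* Let $\delta,H,D>0$ and let $\mathcal H(\delta,H,D)$ be the set of torsion-free groups $\Gamma$ which admit a proper isometric action on some $\delta$-hyperbolic space $(X,d)$ with $\operatorname{Ent}(X,d)\le H$ and $\operatorname{diam}(\Gamma\backslash X)\le D$. Then $\mathcal H(\delta,H,D)$ has cardinality, up to group isomorphism, at most $$N_2(\delta,H,D):=N_1\Big(16\big(\tfrac{\delta}{D}+2\big),\,10HD\Big),$$ where $N_1(\delta,H):=\sum_{i=0}^{N(\delta,H,1)}2^{(2i)^{4\delta+6}}$ and $N(\delta,H,D):=\nu\big(3^5e^{72H(D+\delta)}\big)\cdot\Big(1+\frac{20(D+\delta)}{5D+\delta}\big(\nu(3^5e^{73H(D+4\delta)})+2\big)\Big)$.
   Context: A metric space is $\delta$-hyperbolic if it is proper, geodesic, and every geodesic triangle is $\delta$-thin (any two points of the triangle identified by the canonical tripod approximation, isometric on each side, are at distance $\le\delta$). An isometric action is proper if $\{\gamma:d(x,\gamma x)\le R\}$ is finite for all $R,x$; $\operatorname{diam}(\Gamma\backslash X)$ uses the quotient distance $\inf_\gamma d(x,\gamma y)$. $\operatorname{Ent}(X,d)=\liminf_{R\to\infty}\frac1R\ln\#\{\gamma\in\Gamma:d(x,\gamma x)<R\}$. The function $\nu$ is the nondecreasing integer-valued universal Breuillard–Green–Tao function: for every $K\ge1$, whenever $A,B$ are finite nonempty subsets of a group $G$ with $\#(A\cdot B)\le K(\#A)^{1/2}(\#B)^{1/2}$, there exist a subgroup $G_0$ and a finite normal $L\trianglelefteq G_0$ with $G_0/L$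 nilpotent (with a number of generators bounded in terms of $K$) such that $A$ is covered by $\nu(K)$ left translates of $G_0$. *)

(* Defs.v *)
From Stdlib Require Import Reals List Lia Lra.
Open Scope R_scope.

Record Group := MkGroup {
  gT :> Type;
  gmul : gT -> gT -> gT;
  gone : gT;
  ginv : gT -> gT;
  gassoc : forall x y z, gmul x (gmul y z) = gmul (gmul x y) z;
  gone_l : forall x, gmul gone x = x;
  ginv_l : forall x, gmul (ginv x) x = gone
}.
Arguments gmul {g} _ _.
Arguments gone {g}.
Arguments ginv {g} _.

Fixpoint gpow {G : Group} (g : G) (n : nat) : G :=
  match n with O => gone | S n => gmul g (gpow g n) end.

Definition torsion_free (G : Group) : Prop :=
  forall (g : G) (n : nat), (0 < n)%nat -> gpow g n = gone -> g = gone.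

Definition group_iso (G1 G2 : Group) : Prop :=
  exists (f : G1 -> G2) (h : G2 -> G1),
    (forall x y, f (gmul x y) = gmul (f x) (f y)) /\
    (forall x, h (f x) = x) /\ (forall y, f (h y) = y).

Definition has_card {T : Type} (P : T -> Prop) (n : nat) : Prop :=
  exists l : list T, NoDup l /\ length l = n /\ (forall x, In x l <-> P x).

Definition finite_set {T : Type} (P : T -> Prop) : Prop :=
  exists l : list T, forall x, P x -> In x l.

Definition subgroup {G : Group} (S : G -> Prop) : Prop :=
  S gone /\ (forall x y, S x -> S y -> S (gmul x y)) /\ (forall x, S x -> S (ginv x)).

Definition normal_in {G : Group} (L G0 : G -> Prop) : Prop :=
  subgroup L /\ (forall x, L x -> G0 x) /\
  (forall g x, G0 g -> L x -> L (gmul (ginv g) (gmul x g))).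

Inductive gen {G : Group} (S : G -> Prop) : G -> Prop :=
| gen_base : forall x, S x -> gen S x
| gen_one : gen S gone
| gen_mul : forall x y, gen S x -> gen S y -> gen S (gmul x y)
| gen_inv : forall x, gen S x -> gen S (ginv x).

Definition comm {G : Group} (x y : G) : G :=
  gmul (ginv x) (gmul (ginv y) (gmul x y)).

Fixpoint lcs {G : Group} (G0 : G -> Prop) (k : nat) : G -> Prop :=
  match k with
  | O => G0
  | S k => gen (fun z => exists x y, lcs G0 k x /\ G0 y /\ z = comm x y)
  end.

(* G0/L is nilpotent: some term of the lower central series of G0 lies in L
   (the image of lcs G0 k in G0/L is the k-th term of the l.c.s. of G0/L) *)
Definition nilpotent_mod {G : Group} (G0 L : G -> Prop) : Prop :=
  exists c : nat, forall x, lcs G0 c x -> L x.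

Definition gen_mod_at_most {G : Group} (G0 L : G -> Prop) (k : nat) : Prop :=
  exists gs : list G, (length gs <= k)%nat /\ (forall g, In g gs -> G0 g) /\
    (forall g, G0 g -> gen (fun z => In z gs \/ L z) g).

Definition prodset {G : Group} (A B : G -> Prop) : G -> Prop :=
  fun z => exists a b, A a /\ B b /\ z = gmul a b.

(* Breuillard--Green--Tao property of nu (with some generator bound c) *)
Definition BGT_function (nu : R -> nat) : Prop :=
  (forall K1 K2, 1 <= K1 <= K2 -> (nu K1 <= nu K2)%nat) /\
  exists c : R -> nat,
  forall K, 1 <= K ->
  forall (G : Group) (A B : G -> Prop) (nA nB nAB : nat),
    has_card A nA -> has_card B nB -> (0 < nA)%nat -> (0 < nB)%nat ->
    has_card (prodset A B) nAB ->
    INR nAB <= K * sqrt (INR nA) * sqrt (INR nB) ->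
    exists G0 L : G -> Prop,
      subgroup G0 /\ normal_in L G0 /\ finite_set L /\
      nilpotent_mod G0 L /\ gen_mod_at_most G0 L (c K) /\
      exists ts : list G, (length ts <= nu K)%nat /\
        forall a, A a -> exists t, In t ts /\ G0 (gmul (ginv t) a).

Definition is_metric {X : Type} (d : X -> X -> R) : Prop :=
  (forall x y, 0 <= d x y) /\ (forall x y, d x y = 0 <-> x = y) /\
  (forall x y, d x y = d y x) /\ (forall x y z, d x z <= d x y + d y z).

Definition mopen {X : Type} (d : X -> X -> R) (U : X -> Prop) : Prop :=
  forall x, U x -> exists r, 0 < r /\ forall y, d x y < r -> U y.

Definition mcompact {X : Type} (d : X -> X -> R) (K : X -> Prop) : Prop :=
  forall (I : Type) (U : I -> X -> Prop),
    (forall i, mopen d (U i)) -> (forall x, K x -> exists i, U i x) ->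
    exists l : list I, forall x, K x -> exists i, In i l /\ U i x.

Definition proper_space {X : Type} (d : X -> X -> R) : Prop :=
  forall x r, mcompact d (fun y => d x y <= r).

Definition geod_seg {X : Type} (d : X -> X -> R) (a b : X) (gam : R -> X) : Prop :=
  gam 0 = a /\ gam (d a b) = b /\
  forall s t, 0 <= s <= d a b -> 0 <= t <= d a b -> d (gam s) (gam t) = Rabs (s - t).

Definition geodesic_space {X : Type} (d : X -> X -> R) : Prop :=
  forall a b, exists gam, geod_seg d a b gam.

Definition gprod {X : Type} (d : X -> X -> R) (x y z : X) : R :=
  (d x y + d x z - d y z) / 2.

(* every geodesic triangle is delta-thin: points identified by the tripod
   map (same distance t <= Gromov product from a common vertex) are
   delta-close *)
Definition thin_triangles {X : Type} (d : X -> X -> R) (delta : R) : Prop :=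
  forall (x y z : X) (s1 s2 s3 : R -> X),
    geod_seg d x y s1 -> geod_seg d y z s2 -> geod_seg d z x s3 ->
    (forall t, 0 <= t <= gprod d x y z -> d (s1 t) (s3 (d z x - t)) <= delta) /\
    (forall t, 0 <= t <= gprod d y x z -> d (s1 (d x y - t)) (s2 t) <= delta) /\
    (forall t, 0 <= t <= gprod d z x y -> d (s3 t) (s2 (d y z - t)) <= delta).

Definition hyperbolic_space {X : Type} (d : X -> X -> R) (delta : R) : Prop :=
  is_metric d /\ proper_space d /\ geodesic_space d /\ thin_triangles d delta.

Definition isom_action (G : Group) {X : Type} (d : X -> X -> R) (act : G -> X -> X) : Prop :=
  (forall x, act gone x = x) /\
  (forall g h x, act (gmul g h) x = act g (act h x)) /\
  (forall g x y, d (act g x) (act g y) = d x y).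

Definition proper_action (G : Group) {X : Type} (d : X -> X -> R) (act : G -> X -> X) : Prop :=
  forall x r, finite_set (fun g : G => d x (act g x) <= r).

(* Ent(X,d) = liminf_{R->oo} (1/R) ln #{g : d(x,gx) < R} <= H (basepoint x) *)
Definition entropy_le (G : Group) {X : Type} (d : X -> X -> R) (act : G -> X -> X) (H : R) : Prop :=
  exists x : X, forall eps, 0 < eps -> forall R0,
    exists (Rr : R) (n : nat), R0 <= Rr /\ 0 < Rr /\
      has_card (fun g : G => d x (act g x) < Rr) n /\ ln (INR n) / Rr <= H + eps.

(* diam(Gamma \ X) <= D, with quotient distance inf_g d(x, g y) *)
Definition quotient_diam_le (G : Group) {X : Type} (d : X -> X -> R) (act : G -> X -> X) (D : R) : Prop :=
  forall x y : X, forall eps, 0 < eps -> exists g : G, d x (act g y) <= D + eps.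

Definition in_class_H (delta H D : R) (G : Group) : Prop :=
  torsion_free G /\
  exists (X : Type) (d : X -> X -> R) (act : G -> X -> X),
    hyperbolic_space d delta /\ isom_action G d act /\ proper_action G d act /\
    entropy_le G d act H /\ quotient_diam_le G d act D.

(* x^y for x >= 0, y > 0, with 0^y = 0 *)
Definition rpow (x y : R) : R :=
  match Rle_dec x 0 with left _ => 0 | right _ => Rpower x y end.

Definition Nfun (nu : R -> nat) (delta H D : R) : R :=
  INR (nu (243 * exp (72 * H * (D + delta)))) *
  (1 + 20 * (D + delta) / (5 * D + delta) *
       (INR (nu (243 * exp (73 * H * (D + 4 * delta)))) + 2)).

Definition nat_floor (x : R) : nat := Z.to_nat (Int_part x).

Definition N1 (nu : R -> nat) (delta H : R) : R :=
  sum_f_R0 (fun i => Rpower 2 (rpow (2 * INR i) (4 * delta + 6)))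
           (nat_floor (Nfun nu delta H 1)).

Definition N2 (nu : R -> nat) (delta H D : R) : R :=
  N1 nu (16 * (delta / D + 2)) (10 * H * D).

(* Main.v *)
Require Import Defs.
From Stdlib Require Import Reals List Lia Lra ZArith.
From Stdlib Require Import Classical ClassicalEpsilon Permutation.
Open Scope R_scope.

(** Rescale by D + delta and keep only the length g |-> d(x, g x) on the group:
    it satisfies the four-point condition, and points of the group can be found
    near every point of a geodesic.

    - Doubling.  In a thin annulus of radius L choose a maximal family P of
      elements at mutual distance > L + 25.  For each g in P all but at most one
      h in P make g h nearly geodesic, so P generates (#P - 1)^k distinct products
      of k factors; the entropy bounds #P, hence the annulus by a multiple of the
      ball of radius about L/2.
    - Breuillard-Green-Tao then covers the ball of radius 120 by nu(K) cosets of
      a subgroup G0 which, by torsion-freeness, is nilpotent, hence trivial or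
      centralised by some z <> 1.  Either the ball of radius 10 has at most
      nu(K)^2 elements, or every h in it conjugates a nontrivial element of G0
      into G0.  Since <z> has finite index in its centraliser and z^n has
      linearly growing length, in the second case a power of z is central of finite index
      and the transfer embeds the group in Z.
    - The Rips complex of the ball of radius 10 is simply connected, so the group
      is determined by the partial multiplication table of this ball.

    Counting tables gives a bound far below the last term of the sum N1. *)

Local Notation "a ** b" := (gmul a b) (at level 40, left associativity).
Local Notation "a ^-1" := (ginv a) (at level 3, format "a ^-1").

(** * Groups and counting *)

Section GroupLaws.
Context {G : Group}.
Implicit Types a b c : G.

Lemma gmulA a b c : a ** b ** c = a ** (b ** c).
Proof. symmetry; apply gassoc. Qed.

Lemma gmulKl a b : a^-1 ** (a ** b) = b.
Proof. now rewrite gassoc, ginv_l, gone_l. Qed.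

Lemma gmul_inj_l a b c : a ** b = a ** c -> b = c.
Proof. intros e; rewrite <- (gmulKl a b), e; apply gmulKl. Qed.

Lemma gmul1 a : a ** gone = a.
Proof.
apply (gmul_inj_l a^-1).
now rewrite gassoc, ginv_l, gone_l.
Qed.

Lemma gmulV a : a ** a^-1 = gone.
Proof.
apply (gmul_inj_l a^-1).
now rewrite gassoc, ginv_l, gone_l, gmul1.
Qed.

Lemma gmulVKl a b : a ** (a^-1 ** b) = b.
Proof. now rewrite gassoc, gmulV, gone_l. Qed.

Lemma gmul_inj_r a b c : b ** a = c ** a -> b = c.
Proof.
intros e; rewrite <- (gmul1 b), <- (gmul1 c), <- (gmulV a), !gassoc, e.
reflexivity.
Qed.

Lemma ginvK a : a^-1^-1 = a.
Proof. apply (gmul_inj_l a^-1); now rewrite gmulV, ginv_l. Qed.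

Lemma ginvM a b : (a ** b)^-1 = b^-1 ** a^-1.
Proof.
apply (gmul_inj_l (a ** b)).
now rewrite gmulV, gmulA, gmulVKl, gmulV.
Qed.

Lemma ginv1 : (@gone G)^-1 = gone.
Proof. rewrite <- (gmul1 gone^-1); apply ginv_l. Qed.

End GroupLaws.

Ltac gsimp :=
  repeat (rewrite ginvM || rewrite ginvK || rewrite ginv1 || rewrite gone_l ||
          rewrite gmul1 || rewrite ginv_l || rewrite gmulV || rewrite gmulA ||
          rewrite gmulKl || rewrite gmulVKl).

Section GroupPowers.
Context {G : Group}.
Implicit Types a b g h : G.

Definition commutes a b := a ** b = b ** a.

Lemma gdiv_one a b : a^-1 ** b = gone -> a = b.
Proof. intros e; rewrite <- (gmulVKl a b), e, gmul1; reflexivity. Qed.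

Lemma commutes_mul a b c : commutes a b -> commutes a c -> commutes a (b ** c).
Proof. unfold commutes; intros h1 h2; now rewrite gassoc, h1, gmulA, h2, gassoc. Qed.

Lemma commutes_inv a b : commutes a b -> commutes a b^-1.
Proof.
unfold commutes; intros h; apply (gmul_inj_l b).
now rewrite gmulVKl, gassoc, <- h, gmulA, gmulV, gmul1.
Qed.

Lemma commutes_sym a b : commutes a b -> commutes b a.
Proof. unfold commutes; congruence. Qed.

Lemma commutes_pow a b n : commutes a b -> commutes a (gpow b n).
Proof.
intros h; induction n as [|n IH]; simpl.
- unfold commutes; gsimp; reflexivity.
- now apply commutes_mul.
Qed.

Lemma gpow_add a m n : gpow a (m + n) = gpow a m ** gpow a n.
Proof. induction m as [|m IH]; simpl; gsimp; [|rewrite IH]; reflexivity. Qed.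

Lemma gpow_mul a m n : gpow a (m * n) = gpow (gpow a m) n.
Proof.
induction n as [|n IH].
- now rewrite Nat.mul_0_r.
- now rewrite Nat.mul_succ_r, Nat.add_comm, gpow_add, IH.
Qed.

Lemma gpow_comm a m n : commutes (gpow a m) (gpow a n).
Proof. unfold commutes; now rewrite <- !gpow_add, Nat.add_comm. Qed.

Lemma gpow_Sr a n : gpow a (S n) = gpow a n ** a.
Proof.
replace (S n) with (n + 1)%nat by lia.
rewrite gpow_add; simpl; gsimp; reflexivity.
Qed.

Lemma gpow_inv a n : gpow a^-1 n = (gpow a n)^-1.
Proof.
induction n as [|n IH]; [simpl; now rewrite ginv1|].
rewrite gpow_Sr, IH; simpl; now rewrite ginvM.
Qed.

Lemma gpow_conj h a b n : h ** a = b ** h -> h ** gpow a n = gpow b n ** h.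
Proof.
intros e; induction n as [|n IH]; simpl; [now gsimp|].
now rewrite gassoc, e, gmulA, IH, gassoc.
Qed.

Lemma gpow_inj a m n : torsion_free G -> a <> gone -> gpow a m = gpow a n -> m = n.
Proof.
intros tf ha.
assert (wl : forall i j, (i <= j)%nat -> gpow a i = gpow a j -> i = j).
{ intros i j hij e; destruct (Nat.eq_dec i j) as [|ne]; trivial; exfalso.
  apply ha, (tf a (j - i)%nat); [lia|].
  apply (gmul_inj_l (gpow a i)); rewrite <- gpow_add, gmul1, e.
  f_equal; lia. }
intros e; destruct (Nat.le_ge_cases m n); [|symmetry]; apply wl; auto.
Qed.

Lemma gpow_neq1 a n : torsion_free G -> a <> gone -> (0 < n)%nat -> gpow a n <> gone.
Proof. intros tf ha hn e; exact (ha (tf a n hn e)). Qed.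

End GroupPowers.

(** * Counting with duplicate-free lists *)

Section Counting.

Lemma has_card_of_finite {T} (P : T -> Prop) : finite_set P -> exists n, has_card P n.
Proof.
intros [l hl].
set (dec := fun x => if excluded_middle_informative (P x) then true else false).
set (eqd := fun x y : T => excluded_middle_informative (x = y)).
exists (length (nodup eqd (filter dec l))), (nodup eqd (filter dec l)).
split; [apply NoDup_nodup|split; trivial].
intros x; rewrite nodup_In, filter_In; unfold dec.
destruct (excluded_middle_informative (P x)); split; intuition (auto; discriminate).
Qed.

Lemma has_card_length_le {T} (P : T -> Prop) n l :
  has_card P n -> NoDup l -> (forall x, In x l -> P x) -> (length l <= n)%nat.
Proof.
intros [l' [_ [<- hl']]] nd hl; apply NoDup_incl_length; trivial.
intros x hx; apply hl'; auto.
Qed.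

Lemma has_card_sub {T} (P Q : T -> Prop) n m :
  has_card P n -> has_card Q m -> (forall x, P x -> Q x) -> (n <= m)%nat.
Proof.
intros [l [nd [<- hl]]] hq hpq; apply (has_card_length_le Q); trivial.
intros x hx; apply hpq, hl, hx.
Qed.

Lemma length_cover {A B} (Rel : B -> A -> Prop) (m : nat) (cs : list B) (l : list A) :
  NoDup l -> (forall a, In a l -> exists b, In b cs /\ Rel b a) ->
  (forall b l', In b cs -> NoDup l' -> (forall a, In a l' -> In a l /\ Rel b a) ->
     (length l' <= m)%nat) ->
  (length l <= length cs * m)%nat.
Proof.
revert l; induction cs as [|b cs IH]; intros l nd hc hf.
- destruct l as [|a l]; simpl; [lia|].
  destruct (hc a (or_introl eq_refl)) as [b [[] _]].
- set (f := fun a => if excluded_middle_informative (Rel b a) then true else false).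
  assert (h1 : (length (filter f l) <= m)%nat).
  { apply (hf b); [now left|now apply NoDup_filter|].
    intros a; rewrite filter_In; unfold f.
    destruct (excluded_middle_informative (Rel b a)); intuition (auto; discriminate). }
  assert (h2 : (length (filter (fun a => negb (f a)) l) <= length cs * m)%nat).
  { apply IH; [now apply NoDup_filter| |].
    - intros a; rewrite filter_In; unfold f.
      destruct (excluded_middle_informative (Rel b a)) as [|n]; [easy|].
      intros [ha _]; destruct (hc a ha) as [b' [[<-|hb'] hr]]; [contradiction|eauto].
    - intros b' l' hb' nd' hl'; apply (hf b'); [now right|trivial|].
      intros a ha; destruct (hl' a ha) as [ha' hr].
      rewrite filter_In in ha'; tauto. }
  pose proof (filter_length f l); simpl; lia.
Qed.

Lemma pigeonhole_cover {A B} (Rel : B -> A -> Prop) (cs : list B) (l : list A) :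
  NoDup l -> (forall a, In a l -> exists b, In b cs /\ Rel b a) ->
  (length cs < length l)%nat ->
  exists b a a', In b cs /\ In a l /\ In a' l /\ a <> a' /\ Rel b a /\ Rel b a'.
Proof.
intros nd hc hlt; apply NNPP; intros hn.
assert (h : (length l <= length cs * 1)%nat); [|lia].
apply (length_cover Rel); trivial.
intros b l' hb nd' hl'; destruct l' as [|a [|a' l']]; simpl; try lia; exfalso.
apply hn; exists b, a, a'.
destruct (hl' a) as [h1 h2]; [now left|].
destruct (hl' a') as [h3 h4]; [now right; left|].
repeat split; trivial.
intros <-; inversion nd'; subst; firstorder.
Qed.

(** Greedy choice along the list: an element is added exactly when it is far from all those kept so
    far. The last clause is maximality, which turns a separated family into a net. *)
Lemma maximal_separated {T} (far : T -> T -> Prop) (l : list T) :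
  (forall x, ~ far x x) -> (forall x y, far x y -> far y x) ->
  exists P, incl P l /\ NoDup P /\
    (forall x y, In x P -> In y P -> x <> y -> far x y) /\
    (forall w, In w l -> exists y, In y P /\ ~ far y w).
Proof.
intros irr sym; induction l as [|w l [P [h1 [h2 [h3 h4]]]]].
- exists nil; repeat split; try easy; constructor.
- destruct (classic (exists y, In y P /\ ~ far y w)) as [hy|hy].
  + exists P; repeat split; trivial.
    * intros x hx; right; auto.
    * intros w' [<-|hw]; auto.
  + assert (hf : forall y, In y P -> far y w).
    { intros y hP; apply NNPP; intros hn; apply hy; eauto. }
    exists (w :: P); repeat split.
    * intros x [<-|hx]; [now left|right; auto].
    * constructor; trivial; intros hw; exact (irr w (hf w hw)).
    * intros x y [<-|hx] [<-|hy'] ne; [congruence|apply sym|apply hf|apply h3]; auto.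
    * intros w' [<-|hw]; [exists w; split; [now left|apply irr]|].
      destruct (h4 w' hw) as [y [hy' hn]]; exists y; split; [now right|trivial].
Qed.

Lemma length_filter_pred {T} (f : T -> bool) (l : list T) :
  NoDup l -> (forall x y, In x l -> In y l -> f x = false -> f y = false -> x = y) ->
  (length l <= S (length (filter f l)))%nat.
Proof.
intros nd hu.
enough (length (filter (fun a => negb (f a)) l) <= 1)%nat
  by (pose proof (filter_length f l); lia).
assert (nd' : NoDup (filter (fun a => negb (f a)) l)) by now apply NoDup_filter.
assert (hb : forall x, In x (filter (fun a => negb (f a)) l) -> In x l /\ f x = false).
{ intros x; rewrite filter_In; destruct (f x); simpl; intuition (auto; discriminate). }
destruct (filter (fun a => negb (f a)) l) as [|x [|y q]]; simpl; try lia; exfalso.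
destruct (hb x) as [hx1 hx2]; [now left|].
destruct (hb y) as [hy1 hy2]; [now right; left|].
inversion nd' as [|? ? hx _]; subst; apply hx.
rewrite (hu x y); trivial; now left.
Qed.

Lemma NoDup_flat_map_disjoint {A B} (f : A -> list B) (l : list A) :
  NoDup l -> (forall a, In a l -> NoDup (f a)) ->
  (forall a b x, In a l -> In b l -> In x (f a) -> In x (f b) -> a = b) ->
  NoDup (flat_map f l).
Proof.
induction l as [|a l IH]; intros nd h1 h2; simpl; [constructor|].
inversion nd as [|? ? ha nd']; subst.
apply NoDup_app.
- apply h1; now left.
- apply IH; trivial.
  + intros; apply h1; now right.
  + intros b c x hb hc; apply h2; now right.
- intros x hx hx'; apply in_flat_map in hx' as [b [hb hxb]].
  apply ha; rewrite (h2 a b x); trivial; [now left|now right].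
Qed.

Lemma length_flat_map_ge {A B} (f : A -> list B) (l : list A) m :
  (forall a, In a l -> (m <= length (f a))%nat) ->
  (length l * m <= length (flat_map f l))%nat.
Proof.
induction l as [|a l IH]; intros h; simpl; [lia|].
rewrite length_app.
pose proof (h a (or_introl eq_refl)).
enough (length l * m <= length (flat_map f l))%nat by lia.
apply IH; intros; apply h; now right.
Qed.

End Counting.

(** * Hyperbolic length functions and doubling *)

Lemma exp_le_mono x y : x <= y -> exp x <= exp y.
Proof. intros [h| ->]; [left; now apply exp_increasing|right; reflexivity]. Qed.

Lemma ln_le_mono x y : 0 < x -> x <= y -> ln x <= ln y.
Proof. intros hx [h| ->]; [left; now apply ln_increasing|right; reflexivity]. Qed.

(** Left-invariant pseudo-distance; for an orbit length it is the rescaled distance between orbit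
    points. *)
Definition ldist {G : Group} (l : G -> R) (a b : G) : R := l (a^-1 ** b).

(** What hyperbolicity and geodesicity leave on one orbit. After division by [D + delta], the
    four-point error and the distance from a geodesic to a suitable orbit point are both at most
    2. *)
Record hyp_length {G : Group} (l : G -> R) : Prop := {
  hl_one : l gone = 0;
  hl_inv : forall a, l a^-1 = l a;
  hl_mul : forall a b, l (a ** b) <= l a + l b;
  hl_proper : forall r, finite_set (fun g => l g <= r);
  hl_four : forall a b c e,
    ldist l a c + ldist l b e <=
    Rmax (ldist l a b + ldist l c e) (ldist l b c + ldist l a e) + 2;
  hl_geod : forall a b s, 0 <= s <= ldist l a b ->
    exists c, ldist l a c <= s + 2 /\ ldist l c b <= ldist l a b - s + 2
}.

Definition growth_le {G : Group} (l : G -> R) (H : R) : Prop :=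
  forall eps, 0 < eps -> forall R0, exists (Rr : R) (n : nat),
    R0 <= Rr /\ 0 < Rr /\ has_card (fun g => l g < Rr) n /\
    ln (INR n) / Rr <= H + eps.

Section LengthBasics.
Context {G : Group} {l : G -> R} (hl : hyp_length l).
Implicit Types a b c e g h : G.

Lemma hl_ge0 a : 0 <= l a.
Proof.
pose proof (hl_mul l hl a a^-1) as h.
rewrite gmulV, hl_inv, hl_one in h by trivial; lra.
Qed.

Lemma ldist_ge0 a b : 0 <= ldist l a b.
Proof. apply hl_ge0. Qed.

Lemma ldist_sym a b : ldist l a b = ldist l b a.
Proof. unfold ldist; rewrite <- hl_inv by trivial; now gsimp. Qed.

Lemma ldist_tri a b c : ldist l a c <= ldist l a b + ldist l b c.
Proof.
unfold ldist; replace (a^-1 ** c) with ((a^-1 ** b) ** (b^-1 ** c)) by now gsimp.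
now apply hl_mul.
Qed.

Lemma ldist_mul h a b : ldist l (h ** a) (h ** b) = ldist l a b.
Proof. unfold ldist; now gsimp. Qed.

Lemma ldist_1l a : ldist l gone a = l a.
Proof. unfold ldist; now gsimp. Qed.

Lemma ldist_xx a : ldist l a a = 0.
Proof. unfold ldist; now rewrite ginv_l, hl_one. Qed.

Lemma hl_four_or a b c e :
  ldist l a c + ldist l b e <= ldist l a b + ldist l c e + 2 \/
  ldist l a c + ldist l b e <= ldist l b c + ldist l a e + 2.
Proof.
pose proof (hl_four l hl a b c e) as h; revert h.
apply Rmax_case; auto.
Qed.

Lemma ball_card r : exists n, has_card (fun g => l g <= r) n.
Proof. now apply has_card_of_finite, hl_proper. Qed.

Lemma l_pow_le g n : l (gpow g n) <= INR n * l g.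
Proof.
induction n as [|n IH]; [simpl; rewrite hl_one by trivial; lra|].
rewrite S_INR; simpl; pose proof (hl_mul l hl g (gpow g n)); lra.
Qed.

End LengthBasics.

(** * Products of separated elements of an annulus *)

Section Packing.
Context {G : Group} {l : G -> R} (hl : hyp_length l).
Context (L : R) (hL : 65 <= L) (P : list G).
Context (nd : NoDup P) (hP : forall g, In g P -> L - 20 < l g <= L).
Context (sep : forall g h, In g P -> In h P -> g <> h -> L + 25 < ldist l g h).

(** Gromov product at the identity. *)
Definition gp (a b : G) : R := (l a + l b - ldist l a b) / 2.

Lemma gp_hyp a b c (t : R) : t <= gp a b -> t <= gp b c -> t - 1 <= gp a c.
Proof.
unfold gp; intros h1 h2.
destruct (hl_four_or hl a b c gone) as [h|h];
  rewrite !(ldist_sym hl _ gone), !ldist_1l in h; lra.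
Qed.

(** [gp g^-1 h] is the Gromov product of 1 and [g ** h] seen from [g]: it measures the backtracking
    of the product at [g]. *)
Definition follows (g h : G) : bool :=
  if Rle_dec (gp g^-1 h) (L / 2 - 23 / 2) then true else false.

Fixpoint good_words (k : nat) (g : G) : list G :=
  match k with
  | O => gone :: nil
  | S k => flat_map (fun h => map (gmul h) (good_words k h)) (filter (follows g) P)
  end.

Lemma follows_le g h : follows g h = true -> gp g^-1 h <= L / 2 - 23 / 2.
Proof. unfold follows; destruct Rle_dec; easy. Qed.

(** The length of [g] splits at the point where the path to [g ** v] branches off; the two pieces
    are the Gromov products seen from 1 and from [g]. *)
Lemma gp_shift g v : gp g (g ** v) = l g - gp g^-1 v.
Proof.
unfold gp; rewrite hl_inv by trivial.
replace (ldist l g (g ** v)) with (l v) by (unfold ldist; now gsimp).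
replace (ldist l g^-1 v) with (l (g ** v)) by (unfold ldist; now gsimp).
lra.
Qed.

(** Backtracking does not accumulate: [h ** v'] runs along [h] for more than [L / 2 - 10], so seen
    from [g^-1] only [h] matters. The threshold 23/2 weakens to 21/2 once and for all, by the
    constant 1 of [gp_hyp]. *)
Lemma good_words_prop k g v : In g P -> In v (good_words k g) ->
  gp g^-1 v <= L / 2 - 21 / 2 /\ l v <= INR k * L.
Proof.
revert g v; induction k as [|k IH]; intros g v hg hv.
- destruct hv as [<-|[]].
  unfold gp; rewrite (ldist_sym hl), ldist_1l, (hl_one l hl); simpl; lra.
- simpl in hv; apply in_flat_map in hv as [h [hh hv]].
  apply filter_In in hh as [hh hf].
  apply in_map_iff in hv as [v' [<- hv']].
  destruct (IH h v' hh hv') as [h1 h2].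
  pose proof (hP h hh); split.
  + apply Rnot_lt_le; intros hn.
    pose proof (follows_le _ _ hf) as h3.
    assert (h4 : L / 2 - 21 / 2 + 1 / 2 <= gp (h ** v') h).
    { replace (gp (h ** v') h) with (gp h (h ** v'))
        by (unfold gp; rewrite (ldist_sym hl h); lra).
      rewrite gp_shift; lra. }
    (* The extra 1/2 keeps this minimum strictly above [L / 2 - 21 / 2], so that [gp_hyp]
       contradicts [follows]. *)
    set (m := Rmin (gp g^-1 (h ** v')) (L / 2 - 21 / 2 + 1 / 2)).
    assert (h5 : m - 1 <= gp g^-1 h).
    { apply gp_hyp with (b := h ** v'); [apply Rmin_l|].
      eapply Rle_trans; [apply Rmin_r|exact h4]. }
    unfold m in h5; revert h5; apply Rmin_case; lra.
  + rewrite S_INR; pose proof (hl_mul l hl h v'); lra.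
Qed.

(** A product determines its first factor: two candidates [h], [h'] would have Gromov product at
    least [L / 2 - 11], hence distance at most [L + 22], against separation. *)
Lemma good_words_NoDup k g : In g P -> NoDup (good_words k g).
Proof.
revert g; induction k as [|k IH]; intros g hg; simpl.
- constructor; [easy|constructor].
- apply NoDup_flat_map_disjoint.
  + now apply NoDup_filter.
  + intros h hh; apply filter_In in hh as [hh _].
    apply FinFun.Injective_map_NoDup; [intros x y; apply gmul_inj_l|auto].
  + intros h h' x hh hh' hx hx'.
    apply filter_In in hh as [hh _]; apply filter_In in hh' as [hh' _].
    apply in_map_iff in hx as [v [e hv]]; apply in_map_iff in hx' as [v' [e' hv']].
    destruct (good_words_prop k h v hh hv) as [b1 _].
    destruct (good_words_prop k h' v' hh' hv') as [b2 _].
    pose proof (hP h hh); pose proof (hP h' hh').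
    apply NNPP; intros ne; pose proof (sep h h' hh hh' ne).
    assert (L / 2 - 10 - 1 <= gp h h'); [|unfold gp in *; lra].
    apply gp_hyp with (b := x).
    * rewrite <- e, gp_shift; lra.
    * replace (gp x h') with (gp h' x) by (unfold gp; rewrite (ldist_sym hl h'); lra).
      rewrite <- e', gp_shift; lra.
Qed.

(* Two bad successors of [g] share a long initial segment with [g^-1], so they are not separated. *)
Lemma good_words_length k g : In g P -> ((length P - 1) ^ k <= length (good_words k g))%nat.
Proof.
revert g; induction k as [|k IH]; intros g hg; [simpl; lia|].
cbn [good_words Nat.pow].
eapply Nat.le_trans;
  [|apply length_flat_map_ge with (m := ((length P - 1) ^ k)%nat)].
- apply Nat.mul_le_mono_r.
  enough (length P <= S (length (filter (follows g) P)))%nat by lia.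
  apply length_filter_pred; trivial.
  intros h h' hh hh' e e'; unfold follows in e, e'.
  destruct Rle_dec as [|n]; [easy|]; destruct (Rle_dec (gp g^-1 h')) as [|n']; [easy|].
  apply NNPP; intros ne.
  pose proof (hP h hh); pose proof (hP h' hh'); pose proof (sep h h' hh hh' ne).
  (* This gives distance at most [L + 25], which is where the separation constant comes from. *)
  assert (L / 2 - 23 / 2 - 1 <= gp h h'); [|unfold gp in *; lra].
  apply gp_hyp with (b := g^-1); [|lra].
  replace (gp h g^-1) with (gp g^-1 h) by (unfold gp; rewrite (ldist_sym hl h); lra); lra.
- intros h hh; apply filter_In in hh as [hh _].
  rewrite length_map; auto.
Qed.

(** The [q ^ k] products, with [q] one less than the size of [P], lie in the ball of radius [k * L];
    comparison with the growth at a radius slightly above [k * L] gives [ln q <= 2 * H * L]. *)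
Lemma packing_bound H : 0 < H -> growth_le l H -> INR (length P) <= 2 * exp (2 * H * L).
Proof.
intros hH hgr.
assert (he : 1 <= exp (2 * H * L)).
{ rewrite <- exp_0 at 1; left; apply exp_increasing; apply Rmult_lt_0_compat; lra. }
destruct (le_lt_dec (length P) 1) as [hp|hp].
{ apply le_INR in hp; simpl in hp; lra. }
destruct P as [|g P'] eqn:eP; [simpl in hp; lia|]; rewrite <- eP in *.
assert (hg : In g P) by (rewrite eP; now left).
set (q := (length P - 1)%nat).
enough (hq : INR q <= exp (2 * H * L)).
{ replace (length P) with (S q) by (unfold q; lia); rewrite S_INR; lra. }
assert (hq0 : 0 < INR q) by (apply lt_0_INR; unfold q; lia).
(* With slack [H / 3] the inequality needed is [4 / 3 * (k + 2) <= 2 * k], that is [k >= 4]; radii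
   from [6 * L] on ensure it. *)
destruct (hgr (H / 3) ltac:(lra) (6 * L)) as [Rr [n [h1 [h2 [h3 h4]]]]].
(* [up] exceeds its argument by at most 1, hence [k * L < Rr <= (k + 2) * L]; the left inequality is
   strict because the growth counts open balls. *)
set (k := Z.to_nat (up (Rr / L) - 2)).
destruct (archimed (Rr / L)) as [u1 u2].
assert (hRr : Rr / L * L = Rr) by (field; lra).
assert (hRL : 6 <= Rr / L) by (apply (Rmult_le_reg_r L); lra).
assert (hz : (5 <= up (Rr / L) - 2)%Z).
{ enough (6 < up (Rr / L))%Z by lia; apply lt_IZR; simpl; lra. }
assert (hk : INR k = IZR (up (Rr / L)) - 2).
{ unfold k; rewrite INR_IZR_INZ, Z2Nat.id, minus_IZR by lia; reflexivity. }
assert (hk5 : 5 <= INR k) by (rewrite hk, <- minus_IZR; now apply IZR_le).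
assert (b1 : INR k * L < Rr) by (rewrite <- hRr; apply Rmult_lt_compat_r; lra).
assert (b2 : Rr <= (INR k + 2) * L) by (rewrite <- hRr; apply Rmult_le_compat_r; lra).
assert (hn : (q ^ k <= n)%nat).
{ eapply Nat.le_trans; [apply (good_words_length k g hg)|].
  apply (has_card_length_le _ _ _ h3); [now apply good_words_NoDup|].
  intros v hv; destruct (good_words_prop k g v hg hv); lra. }
assert (hln : INR k * ln (INR q) <= ln (INR n)).
{ apply le_INR in hn; rewrite pow_INR in hn.
  rewrite <- ln_pow by trivial.
  apply ln_le_mono; trivial; now apply pow_lt. }
assert (h5 : ln (INR n) <= (H + H / 3) * Rr).
{ replace (ln (INR n)) with (ln (INR n) / Rr * Rr) by (field; lra).
  apply Rmult_le_compat_r; lra. }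
assert (h6 : (H + H / 3) * Rr <= INR k * (2 * H * L)).
{ eapply Rle_trans; [apply Rmult_le_compat_l; [lra|exact b2]|].
  assert (0 <= H * L * (INR k - 4)) by (repeat apply Rmult_le_pos; lra).
  nra. }
rewrite <- (exp_ln (INR q)) by trivial.
apply exp_le_mono, (Rmult_le_reg_l (INR k)); lra.
Qed.

End Packing.

(** Balls of radius [L + 25] about a maximal separated family cover the annulus. The part of such a
    ball inside the annulus lies within [L / 2 + 73 / 2] of a point [c] on the segment from 1 to the
    centre. *)
Lemma annulus_card {G : Group} {l : G -> R} (H L : R) (nA nB : nat) :
  hyp_length l -> growth_le l H -> 0 < H -> 65 <= L ->
  has_card (fun g => L - 20 < l g <= L) nA ->
  has_card (fun g => l g <= L / 2 + 73 / 2) nB ->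
  INR nA <= 2 * exp (2 * H * L) * INR nB.
Proof.
intros hl hgr hH hL [la [ndA [<- hA]]] hB.
destruct (maximal_separated (fun g h => L + 25 < ldist l g h) la) as [P [p1 [p2 [p3 p4]]]].
- intros x; rewrite (ldist_xx hl); lra.
- intros x y; rewrite (ldist_sym hl x); trivial.
- assert (hc : (length la <= length P * nB)%nat).
  { apply (length_cover (fun y w => ldist l y w <= L + 25)); trivial.
    - intros w hw; destruct (p4 w hw) as [y [hy hn]]; exists y; split; trivial; lra.
    - intros y l' hy nd' hl'; pose proof (proj1 (hA y) (p1 y hy)) as hy'.
      (* The assumption [65 <= L] makes this parameter non-negative. *)
      destruct (hl_geod l hl gone y (L / 2 - 65 / 2)) as [c [c1 c2]].
      { rewrite ldist_1l; lra. }
      rewrite ldist_1l in c1, c2.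
      rewrite <- (length_map (gmul c^-1) l').
      apply (has_card_length_le _ _ _ hB).
      + apply FinFun.Injective_map_NoDup; trivial; intros u v; apply gmul_inj_l.
      + intros v hv; apply in_map_iff in hv as [w [<- hw]].
        destruct (hl' w hw) as [hw1 hw2]; apply hA in hw1.
        change (ldist l c w <= L / 2 + 73 / 2).
        (* The two alternatives bound [ldist l c w] by [L / 2 + 33 / 2] and by [L / 2 + 73 / 2]. *)
        pose proof (hl_four_or hl c gone w y) as h4.
        rewrite !ldist_1l, (ldist_sym hl c gone), ldist_1l, (ldist_sym hl w y) in h4.
        destruct h4; lra. }
  pose proof (packing_bound hl L hL P p2 (fun g hg => proj1 (hA g) (p1 g hg)) p3 H hH hgr).
  apply le_INR in hc; rewrite mult_INR in hc.
  eapply Rle_trans; [exact hc|].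
  apply Rmult_le_compat_r; [apply pos_INR|trivial].
Qed.

Lemma ball_card_step {G : Group} {l : G -> R} (H L b : R) (n1 n2 nb : nat) :
  hyp_length l -> growth_le l H -> 0 < H -> 65 <= L -> L / 2 + 73 / 2 <= b ->
  has_card (fun g => l g <= L) n1 ->
  has_card (fun g => l g <= L - 20) n2 ->
  has_card (fun g => l g <= b) nb ->
  INR n1 <= INR n2 + 2 * exp (2 * H * L) * INR nb.
Proof.
intros hl hgr hH hL hb h1 h2 h3.
destruct (has_card_of_finite (fun g => L - 20 < l g <= L)) as [nA hA].
{ destruct (hl_proper l hl L) as [q hq]; exists q; intros x hx; apply hq; lra. }
destruct (ball_card hl (L / 2 + 73 / 2)) as [nB hB].
pose proof (annulus_card H L nA nB hl hgr hH hL hA hB) as h4.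
assert (h5 : (nB <= nb)%nat).
{ apply (has_card_sub _ _ _ _ hB h3); intros x hx; lra. }
assert (h6 : (n1 <= n2 + nA)%nat).
{ destruct h2 as [q2 [_ [<- hq2]]]; destruct hA as [qA [_ [<- hqA]]].
  destruct h1 as [q1 [nd [<- hq1]]]; rewrite <- length_app.
  apply NoDup_incl_length; trivial; intros x hx; apply hq1 in hx; apply in_app_iff.
  rewrite hq2, hqA; lra. }
apply le_INR in h5, h6; rewrite plus_INR in h6.
assert (2 * exp (2 * H * L) * INR nB <= 2 * exp (2 * H * L) * INR nb).
{ apply Rmult_le_compat_l; trivial; pose proof (exp_pos (2 * H * L)); lra. }
lra.
Qed.

(** Four annuli of width 20 lead from radius 240 to 160 and two from 160 to 120, because
    [L / 2 + 73 / 2] is below 160 for [L <= 240] and below 120 for [L <= 160]. The factors combine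
    to [9 * 5 <= 243], the exponents to [480 * H + 320 * H]. *)
Lemma ball_doubling {G : Group} {l : G -> R} (H : R) (n1 n2 : nat) :
  hyp_length l -> growth_le l H -> 0 < H ->
  has_card (fun g => l g <= 240) n2 -> has_card (fun g => l g <= 120) n1 ->
  INR n2 <= 243 * exp (800 * H) * INR n1.
Proof.
intros hl hgr hH h240 h120.
destruct (ball_card hl 140) as [n140 h140]; destruct (ball_card hl 160) as [n160 h160].
destruct (ball_card hl 180) as [n180 h180]; destruct (ball_card hl 200) as [n200 h200].
destruct (ball_card hl 220) as [n220 h220].
assert (step : forall L b m1 m2 mb M, 65 <= L <= M -> L / 2 + 73 / 2 <= b ->
  has_card (fun g => l g <= L) m1 -> has_card (fun g => l g <= L - 20) m2 ->
  has_card (fun g => l g <= b) mb -> INR m1 <= INR m2 + 2 * exp (2 * H * M) * INR mb).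
{ intros L b m1 m2 mb M hL hb c1 c2 c3.
  pose proof (ball_card_step H L b m1 m2 mb hl hgr hH (proj1 hL) hb c1 c2 c3) as c.
  assert (exp (2 * H * L) <= exp (2 * H * M)).
  { apply exp_le_mono, Rmult_le_compat_l; lra. }
  pose proof (pos_INR mb).
  assert (exp (2 * H * L) * INR mb <= exp (2 * H * M) * INR mb) by (now apply Rmult_le_compat_r).
  lra. }
set (e1 := exp (2 * H * 240)) in *; set (e2 := exp (2 * H * 160)) in *.
assert (s1 : INR n2 <= INR n220 + 2 * e1 * INR n160).
{ apply (step 240 160); trivial; try lra; now replace (240 - 20) with 220 by lra. }
assert (s2 : INR n220 <= INR n200 + 2 * e1 * INR n160).
{ apply (step 220 160); trivial; try lra; now replace (220 - 20) with 200 by lra. }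
assert (s3 : INR n200 <= INR n180 + 2 * e1 * INR n160).
{ apply (step 200 160); trivial; try lra; now replace (200 - 20) with 180 by lra. }
assert (s4 : INR n180 <= INR n160 + 2 * e1 * INR n160).
{ apply (step 180 160); trivial; try lra; now replace (180 - 20) with 160 by lra. }
assert (s5 : INR n160 <= INR n140 + 2 * e2 * INR n1).
{ apply (step 160 120); trivial; try lra; now replace (160 - 20) with 140 by lra. }
assert (s6 : INR n140 <= INR n1 + 2 * e2 * INR n1).
{ apply (step 140 120); trivial; try lra; now replace (140 - 20) with 120 by lra. }
assert (he : forall x, 0 <= x -> 1 <= exp x) by (intros x hx; rewrite <- exp_0; now apply exp_le_mono).
assert (1 <= e1) by (apply he; lra).
assert (1 <= e2) by (apply he; lra).
replace (exp (800 * H)) with (e1 * e2) by (unfold e1, e2; rewrite <- exp_plus; f_equal; lra).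
pose proof (pos_INR n1); pose proof (pos_INR n160).
assert (t1 : INR n2 <= 9 * e1 * INR n160) by nra.
assert (t2 : INR n160 <= 5 * e2 * INR n1) by nra.
assert (t3 : 9 * e1 * INR n160 <= 9 * e1 * (5 * e2 * INR n1)) by (apply Rmult_le_compat_l; lra).
assert (0 <= e1 * e2 * INR n1) by (repeat apply Rmult_le_pos; lra).
lra.
Qed.

(** * Reconstruction from a multiplication table *)

Lemma INR_above (x : R) : exists n, x <= INR n.
Proof.
destruct (INR_unbounded x) as [n hn]; exists n; lra.
Qed.

(** * Extension of a partial homomorphism from a ball *)

Section Extension.
Context {G : Group} {l : G -> R} (hl : hyp_length l).

(** A point 5 before the end of the segment from 1 to [g], up to the error 2. The condition
    [10 < l g] stands under the existential so that choice yields a total function. *)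
Lemma closer_point g : exists w, 10 < l g -> l w <= l g - 3 /\ ldist l w g <= 7.
Proof.
destruct (Rlt_le_dec 10 (l g)) as [h|h]; [|exists gone; lra].
destruct (hl_geod l hl gone g (l g - 5)) as [w hw]; rewrite ldist_1l in *; [lra|].
rewrite ldist_1l in hw; exists w; intros _; lra.
Qed.

Lemma ball_ind (Q : G -> Prop) :
  (forall g, l g <= 10 -> Q g) ->
  (forall w s, Q w -> l s <= 10 -> Q (w ** s)) -> forall g, Q g.
Proof.
intros h1 h2 g; destruct (INR_above (l g)) as [n hn]; revert g hn.
induction n as [|n IH]; intros g hn.
- apply h1; simpl in hn; lra.
- destruct (Rle_lt_dec (l g) 10) as [h|h]; [auto|].
  destruct (closer_point g) as [w hw]; destruct (hw h) as [hw1 hw2].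
  rewrite <- (gmulVKl w g); apply h2; [apply IH; rewrite S_INR in hn; lra|].
  unfold ldist in hw2; lra.
Qed.

Context {G' : Group} (f : G -> G').
Context (hf : forall a b, l a <= 10 -> l b <= 10 -> l (a ** b) <= 10 -> f (a ** b) = f a ** f b).
Context (w : G -> G).
Context (hw : forall g, 10 < l g -> l (w g) <= l g - 3 /\ ldist l (w g) g <= 7).

(** The value is read along the path [g], [w g], [w (w g)] and so on, down to the ball. Each step
    shortens by 3, so with fuel [n >= l g] the default [gone] is never reached. *)
Fixpoint ext_fuel (n : nat) (g : G) : G' :=
  if Rle_dec (l g) 10 then f g else
  match n with
  | O => gone
  | S n => ext_fuel n (w g) ** f ((w g)^-1 ** g)
  end.

Lemma ext_fuel_stable n m g : l g <= INR n -> l g <= INR m -> ext_fuel n g = ext_fuel m g.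
Proof.
revert m g; induction n as [|n IH]; intros m g hn hm.
- simpl in hn; destruct m; simpl; destruct (Rle_dec (l g) 10); trivial; lra.
- destruct m as [|m].
  + simpl in hm; simpl; destruct (Rle_dec (l g) 10); trivial; lra.
  + simpl; destruct (Rle_dec (l g) 10) as [h|h]; trivial; f_equal.
    rewrite S_INR in hn, hm; destruct (hw g); [lra|]; apply IH; lra.
Qed.

Definition ext (g : G) : G' :=
  ext_fuel (proj1_sig (constructive_indefinite_description _ (INR_above (l g)))) g.

Lemma ext_fuelE n g : l g <= INR n -> ext g = ext_fuel n g.
Proof.
intros h; unfold ext; destruct constructive_indefinite_description as [m hm]; simpl.
now apply ext_fuel_stable.
Qed.

Lemma ext_ball g : l g <= 10 -> ext g = f g.
Proof.
intros h; destruct (INR_above (l g)) as [n hn]; rewrite (ext_fuelE n) by trivial.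
destruct n; simpl; destruct (Rle_dec (l g) 10); easy.
Qed.

Lemma ext_far g : 10 < l g -> ext g = ext (w g) ** f ((w g)^-1 ** g).
Proof.
intros h; destruct (INR_above (l g)) as [n hn].
destruct (hw g h) as [h1 _].
rewrite (ext_fuelE (S n) g), (ext_fuelE n (w g)) by (try rewrite S_INR; lra).
simpl; destruct (Rle_dec (l g) 10); [lra|reflexivity].
Qed.

Lemma partial_inv s : l s <= 10 -> f s^-1 = (f s)^-1.
Proof.
intros hs.
assert (h0 : l gone <= 10) by (rewrite hl_one by trivial; lra).
assert (f1 : f gone = gone).
{ apply (gmul_inj_l (f gone)); rewrite gmul1, <- hf by (gsimp; trivial); now gsimp. }
apply (gmul_inj_l (f s)); rewrite gmulV, <- f1, <- (gmulV s).
symmetry; apply hf; [trivial|now rewrite hl_inv|now rewrite gmulV].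
Qed.

(* If [g] is the farther of two adjacent points, the point [w g] is adjacent to both. *)
Lemma ext_adjacent g h : ldist l g h <= 10 -> ext h = ext g ** f (g^-1 ** h).
Proof.
destruct (INR_above (l g + l h)) as [n hn]; revert g h hn.
assert (wl : forall n,
  (forall g h, l g + l h <= INR n -> ldist l g h <= 10 -> ext h = ext g ** f (g^-1 ** h)) ->
  forall g h, l g + l h <= INR (S n) -> ldist l g h <= 10 -> l h <= l g -> ext h = ext g ** f (g^-1 ** h)).
{ clear n; intros n IH g h hn hd hgh; rewrite S_INR in hn; unfold ldist in hd.
  destruct (Rle_lt_dec (l g) 10) as [hg|hg].
  - rewrite !ext_ball by lra; rewrite <- hf by (trivial; rewrite gmulVKl; lra).
    now rewrite gmulVKl.
  - destruct (hw g hg) as [h1 h2].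
    (* Both alternatives give at most 9, as [-3 + 10 + 2] or as [7 + 2]. *)
    assert (h3 : ldist l (w g) h <= 10).
    { pose proof (hl_four_or hl (w g) gone h g) as h4.
      rewrite !ldist_1l, (ldist_sym hl (w g) gone), ldist_1l, (ldist_sym hl h g) in h4.
      unfold ldist in *; destruct h4; lra. }
    (* The induction hypothesis handles the pair [w g], [h]; the triangle on [w g], [g], [h] has
       sides at most 10, so [hf] closes it. *)
    rewrite (IH (w g) h), (ext_far g hg), gmulA by (trivial; lra); f_equal.
    unfold ldist in h2, h3; rewrite <- hf; try lra; [f_equal; now gsimp|].
    replace ((w g)^-1 ** g ** (g^-1 ** h)) with ((w g)^-1 ** h) by (now gsimp).
    lra. }
induction n as [|n IH].
- intros g h hn hd; apply (wl 0%nat); trivial.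
  + intros g' h' hn' hd'; simpl in hn'.
    pose proof (hl_ge0 hl g'); pose proof (hl_ge0 hl h').
    rewrite !ext_ball by lra; unfold ldist in hd'.
    rewrite <- hf by (trivial; try rewrite gmulVKl; lra); now rewrite gmulVKl.
  + rewrite S_INR; lra.
  + simpl in hn; pose proof (hl_ge0 hl g); pose proof (hl_ge0 hl h); lra.
- intros g h hn hd; destruct (Rle_dec (l h) (l g)) as [hc|hc]; [now apply (wl n)|].
  rewrite (wl n IH h g); [|lra|now rewrite ldist_sym|lra].
  unfold ldist in hd.
  replace (h^-1 ** g) with (g^-1 ** h)^-1 by now gsimp.
  rewrite partial_inv by trivial; now gsimp.
Qed.

Lemma ext_mul a b : ext (a ** b) = ext a ** ext b.
Proof.
revert b; apply ball_ind.
- intros b hb; rewrite (ext_adjacent a) by (unfold ldist; now rewrite gmulKl).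
  now rewrite gmulKl, (ext_ball b).
- intros v s IH hs.
  rewrite (ext_adjacent (a ** v)), (ext_adjacent v (v ** s)), IH
    by (unfold ldist; gsimp; trivial).
  now gsimp.
Qed.

End Extension.

(** Algebraic form of simple connectivity of the Rips complex: the group is presented by its ball of
    radius 10 and the products that stay in it. *)
Lemma partial_hom_extends {G G' : Group} (l : G -> R) (f : G -> G') :
  hyp_length l ->
  (forall a b, l a <= 10 -> l b <= 10 -> l (a ** b) <= 10 -> f (a ** b) = f a ** f b) ->
  exists phi : G -> G', (forall a b, phi (a ** b) = phi a ** phi b) /\
    (forall a, l a <= 10 -> phi a = f a).
Proof.
intros hl hf.
set (w := fun g => proj1_sig (constructive_indefinite_description _ (closer_point hl g))).
assert (hw : forall g, 10 < l g -> l (w g) <= l g - 3 /\ ldist l (w g) g <= 7).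
{ intros g; unfold w; destruct constructive_indefinite_description as [v hv]; exact hv. }
exists (@ext G l G' f w); split.
- exact (ext_mul hl f hf w hw).
- exact (ext_ball f w hw).
Qed.

(** Positions replace elements, so that tables of different groups can be compared. All indices are
    in range, so the default of [nth] never shows. *)
Definition mult_table {G : Group} (s : list G) : list bool :=
  map (fun t => if excluded_middle_informative
         (nth (fst (fst t)) s gone ** nth (snd (fst t)) s gone = nth (snd t) s gone)
       then true else false)
    (list_prod (list_prod (seq 0 (length s)) (seq 0 (length s))) (seq 0 (length s))).

Lemma length_mult_table {G : Group} (s : list G) :
  length (mult_table s) = (length s * length s * length s)%nat.
Proof. unfold mult_table; now rewrite length_map, !length_prod, length_seq. Qed.

(** Matching equal positions is a partial homomorphism because the tables agree, and it extends from
    the ball. *)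
Lemma mult_table_hom {G G' : Group} (s : list G) (s' : list G') (l : G -> R) :
  hyp_length l -> NoDup s -> (forall g, In g s <-> l g <= 10) -> length s = length s' ->
  mult_table s = mult_table s' ->
  exists phi : G -> G', (forall a b, phi (a ** b) = phi a ** phi b) /\
    (forall i, (i < length s)%nat -> phi (nth i s gone) = nth i s' gone).
Proof.
intros hl nd hs hlen e; unfold mult_table in e; rewrite <- hlen in e.
pose proof (ext_in_map e) as he; clear e.
(* Outside the ball the position 0 is an arbitrary value. *)
assert (hidx : forall g, exists i, l g <= 10 -> (i < length s)%nat /\ nth i s gone = g).
{ intros g; destruct (Rle_dec (l g) 10) as [h|h]; [|exists 0%nat; easy].
  apply hs in h; destruct (In_nth _ _ gone h) as [i hi]; exists i; trivial. }
set (idx := fun g => proj1_sig (constructive_indefinite_description _ (hidx g))).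
assert (hi : forall g, l g <= 10 -> (idx g < length s)%nat /\ nth (idx g) s gone = g).
{ intros g; unfold idx; destruct constructive_indefinite_description as [i hi]; exact hi. }
destruct (partial_hom_extends l (fun g => nth (idx g) s' gone) hl) as [phi [p1 p2]].
- intros a b ha hb hab.
  destruct (hi a ha) as [a1 a2], (hi b hb) as [b1 b2], (hi _ hab) as [c1 c2].
  specialize (he (idx a, idx b, idx (a ** b))); simpl in he.
  rewrite a2, b2, c2 in he.
  destruct (excluded_middle_informative (a ** b = a ** b)) as [_|n]; [|easy].
  destruct excluded_middle_informative as [e|]; [now rewrite e|].
  enough (true = false) by discriminate.
  apply he, in_prod; [apply in_prod|]; apply in_seq; lia.
- exists phi; split; trivial; intros i hlt.
  assert (h10 : l (nth i s gone) <= 10) by (apply hs, nth_In; trivial).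
  rewrite p2 by trivial; f_equal.
  destruct (hi _ h10) as [h1 h2]; eapply NoDup_nth; eauto.
Qed.

Lemma cube_inj (a b : nat) : (a * a * a = b * b * b)%nat -> a = b.
Proof.
assert (h : forall x y : nat, (x < y -> x * x * x < y * y * y)%nat).
{ intros x y h; assert (x * x < y * y)%nat by nia; nia. }
intros e; destruct (lt_eq_lt_dec a b) as [[c|c]|c]; trivial; apply h in c; lia.
Qed.

(** The table length is the cube of the ball size, so both balls have the same size. The two
    extensions invert each other on the balls, which generate. *)
Lemma mult_table_iso {G G' : Group} (s : list G) (s' : list G') (l : G -> R) (l' : G' -> R) :
  hyp_length l -> hyp_length l' -> NoDup s -> NoDup s' ->
  (forall g, In g s <-> l g <= 10) -> (forall g, In g s' <-> l' g <= 10) ->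
  mult_table s = mult_table s' -> group_iso G G'.
Proof.
intros hl hl' nd nd' hs hs' e.
assert (hlen : length s = length s').
{ pose proof (length_mult_table s) as h1; pose proof (length_mult_table s') as h2.
  rewrite e in h1; rewrite h1 in h2.
  now apply cube_inj. }
destruct (mult_table_hom s s' l hl nd hs hlen e) as [phi [p1 p2]].
destruct (mult_table_hom s' s l' hl' nd' hs' (eq_sym hlen) (eq_sym e)) as [psi [q1 q2]].
exists phi, psi; split; [exact p1|split].
- apply (ball_ind hl).
  + intros g hg; apply hs in hg; destruct (In_nth _ _ gone hg) as [i [hi <-]].
    rewrite p2, q2; trivial; lia.
  + intros w x hw hx; rewrite p1, q1, hw; f_equal.
    apply hs in hx; destruct (In_nth _ _ gone hx) as [i [hi <-]].
    rewrite p2, q2; trivial; lia.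
- apply (ball_ind hl').
  + intros g hg; apply hs' in hg; destruct (In_nth _ _ gone hg) as [i [hi <-]].
    rewrite q2, p2; trivial; lia.
  + intros w x hw hx; rewrite q1, p1, hw; f_equal.
    apply hs' in hx; destruct (In_nth _ _ gone hx) as [i [hi <-]].
    rewrite q2, p2; trivial; lia.
Qed.

(** * Centralizers *)

Lemma Rabs_le_inv a b : Rabs a <= b -> - b <= a <= b.
Proof.
intros h; pose proof (Rle_abs a); pose proof (Rle_abs (- a)) as h2.
rewrite Rabs_Ropp in h2; lra.
Qed.

Section Centralizers.
Context {G : Group} {l : G -> R} (hl : hyp_length l) (tf : torsion_free G).
Implicit Types g h u y : G.

Lemma NoDup_powers g n : g <> gone -> NoDup (map (gpow g) (seq 0 n)).
Proof.
intros hg; apply FinFun.Injective_map_NoDup; [|apply seq_NoDup].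
intros i j; now apply gpow_inj.
Qed.

Lemma l_pow_unbounded g B : g <> gone -> exists n, B < l (gpow g n).
Proof.
intros hg; destruct (ball_card hl B) as [c hc]; apply NNPP; intros hn.
assert (h : (length (map (gpow g) (seq 0 (S c))) <= c)%nat).
{ apply (has_card_length_le _ _ _ hc); [now apply NoDup_powers|].
  intros x hx; apply in_map_iff in hx as [i [<- _]].
  apply Rnot_lt_le; intros hi; apply hn; now exists i. }
rewrite length_map, length_seq in h; lia.
Qed.

(** [tau] is a quasi-morphism on the elements of length at most [m] in the centraliser of [g]: an
    approximate signed translation along [g]. By [sh_dist], elements with close shifts move [y] to
    close points, so that properness can bound their number. *)
Record is_shift g (m : R) y (tau : G -> R) : Prop := {
  sh_le : forall h, Rabs (tau h) <= l h;
  sh_dist : forall h k, commutes g h -> commutes g k -> l h <= m -> l k <= m ->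
    ldist l (h ** y) (k ** y) <= Rabs (tau h - tau k) + 10;
  sh_mul : forall h k, commutes g h -> commutes g k -> l h <= m -> l k <= m ->
    Rabs (tau (h ** k) - tau h - tau k) <= 2 }.

(* [y] is the midpoint of a long segment from 1 to a power of [g]; every [h] commuting with [g]
   moves both endpoints by [l h] only, hence slides [y] along the segment by [tau h]. *)
Lemma shift_exists g m : g <> gone -> 0 <= m -> exists y tau, is_shift g m y tau.
Proof.
(* A length of [q] this large compared with [m] excludes the degenerate alternatives of the
   four-point conditions below. *)
intros hg hm; destruct (l_pow_unbounded g (10 * m + 100) hg) as [n hn].
set (q := gpow g n) in *.
destruct (hl_geod l hl gone q (l q / 2)) as [y [y1 y2]]; rewrite ldist_1l in *; [lra|].
pose proof (ldist_tri hl gone y q) as y3; rewrite !ldist_1l in y3.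
exists y, (fun h => l (h ** y) - l y).
assert (hle : forall h, Rabs (l (h ** y) - l y) <= l h).
{ intros h; pose proof (hl_mul l hl h y); pose proof (hl_mul l hl h^-1 (h ** y)) as h2.
  rewrite gmulKl, hl_inv in h2 by trivial; apply Rabs_le; lra. }
(* The endpoints [h] and [h ** q = q ** h] of the translated segment are at distance [l h] from 1
   and [q], so [h ** y] stays near the segment from 1 to [q]. Two four-point errors and the two
   errors of [y] add up to 8. *)
assert (hax : forall h, commutes g h -> l h <= m -> l (h ** y) + ldist l (h ** y) q <= l q + 8).
{ intros h hc hlm.
  assert (hq : h ** q = q ** h) by (apply commutes_pow, commutes_sym, hc).
  pose proof (hle h) as hb; apply Rabs_le_inv in hb.
  pose proof (hl_four_or hl gone h (h ** y) (h ** q)) as a1.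
  pose proof (hl_four_or hl (h ** y) (h ** q) q gone) as a2.
  assert (e1 : ldist l h (h ** y) = l y) by (unfold ldist; now gsimp).
  assert (e2 : ldist l h (h ** q) = l q) by (unfold ldist; now gsimp).
  assert (e3 : ldist l (h ** q) q = l h).
  { rewrite hq; unfold ldist; gsimp; now apply hl_inv. }
  pose proof (hl_mul l hl (q ** h) h^-1) as a3.
  rewrite gmulA, gmulV, gmul1, hl_inv in a3 by trivial.
  rewrite ldist_mul, ?(ldist_sym hl _ gone), !ldist_1l, e1, e2 in a1.
  rewrite ldist_mul, ?(ldist_sym hl _ gone), !ldist_1l, e3 in a2.
  rewrite hq in a1, a2.
  pose proof (ldist_ge0 hl (h ** y) q).
  pose proof (hl_ge0 hl (h ** y)).
  destruct a1, a2; lra. }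
assert (hd : forall h k, commutes g h -> commutes g k -> l h <= m -> l k <= m ->
    ldist l (h ** y) (k ** y) <= Rabs (l (h ** y) - l y - (l (k ** y) - l y)) + 10).
{ intros h k hc hc' hm1 hm2.
  pose proof (hax h hc hm1); pose proof (hax k hc' hm2).
  pose proof (hl_four_or hl (h ** y) gone (k ** y) q) as a1.
  rewrite ?(ldist_sym hl _ gone), !ldist_1l in a1.
  pose proof (Rle_abs (l (h ** y) - l y - (l (k ** y) - l y))).
  pose proof (Rle_abs (- (l (h ** y) - l y - (l (k ** y) - l y)))) as a2.
  rewrite Rabs_Ropp in a2.
  destruct a1; lra. }
split; trivial.
intros h k hc hc' hm1 hm2.
assert (h1 : ldist l (h ** k ** y) (h ** y) <= m + 10).
{ rewrite gmulA, ldist_mul; pose proof (hd k gone hc' ltac:(unfold commutes; now gsimp) hm2) as hd1.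
  rewrite hl_one, gone_l in hd1 by trivial.
  replace (l (k ** y) - l y - (l y - l y)) with (l (k ** y) - l y) in hd1 by lra.
  pose proof (hle k); specialize (hd1 hm); lra. }
pose proof (hle h) as hb1; pose proof (hle k) as hb2.
pose proof (Rle_abs (l (h ** y) - l y)); pose proof (Rle_abs (- (l (h ** y) - l y))) as hb3.
rewrite Rabs_Ropp in hb3.
(* [a1] gives the upper and [a2] the lower bound; their other alternatives fail because [y] is far
   from 1. *)
pose proof (hl_four_or hl gone h (h ** k ** y) (h ** y)) as a1.
pose proof (hl_four_or hl h gone (h ** k ** y) (h ** y)) as a2.
assert (e1 : ldist l h (h ** y) = l y) by (unfold ldist; now gsimp).
assert (e2 : ldist l h (h ** k ** y) = l (k ** y)) by (unfold ldist; now gsimp).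
rewrite !ldist_1l, e1, e2 in a1; rewrite !ldist_1l, e1, e2 in a2.
pose proof (hl_ge0 hl (h ** k ** y)); pose proof (hl_ge0 hl (k ** y)).
rewrite (ldist_sym hl h gone), ldist_1l in a2.
cbv beta; apply Rabs_le; destruct a1, a2; lra.
Qed.

(** Each factor costs the error 2 of the quasi-morphism. The sign [eps] covers both directions of
    translation. *)
Lemma shift_pow g m y tau (eps : R) u n :
  is_shift g m y tau -> 0 <= m -> (eps = 1 \/ eps = -1) -> commutes g u ->
  INR n * l u <= m -> INR n * (eps * tau u - 2) <= eps * tau (gpow u n).
Proof.
intros sh hm he hc; induction n as [|n IH]; intros hn.
- simpl; pose proof (sh_le _ _ _ _ sh gone) as h; rewrite (hl_one l hl) in h.
  apply Rabs_le_inv in h; destruct he; subst; lra.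
- rewrite S_INR in *; pose proof (hl_ge0 hl u); pose proof (pos_INR n).
  pose proof (l_pow_le hl u n).
  assert (0 <= INR n * l u) by now apply Rmult_le_pos.
  assert (h1 : l (gpow u n) <= m) by lra.
  assert (h2 : l u <= m) by lra.
  pose proof (sh_mul _ _ _ _ sh u (gpow u n) hc (commutes_pow _ _ n hc) h2 h1) as h.
  apply Rabs_le_inv in h; simpl; specialize (IH ltac:(lra)); destruct he; subst; lra.
Qed.

(* If the first powers of [g] all had bounded shift, they would be too many elements
   moving [y] by a bounded amount. *)
Lemma shift_growth g : g <> gone -> exists P, (0 < P)%nat /\ forall m, 0 <= m ->
  exists y tau eps, is_shift g m y tau /\ (eps = 1 \/ eps = -1) /\
    forall k, INR (P * k) * l g <= m -> 18 * INR k <= eps * tau (gpow g (P * k)).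
Proof.
intros hg; destruct (ball_card hl 30) as [c hc].
(* The exponent [j <= c] found below depends on the scale [m]; the factorial is a multiple of every
   such [j], so one [P] serves all scales. *)
exists (fact c); split; [apply lt_O_fact|]; intros m0 hm0.
pose proof (hl_ge0 hl g) as hlg; pose proof (pos_INR c).
assert (hcg : 0 <= INR c * l g) by now apply Rmult_le_pos.
set (m := m0 + INR c * l g).
assert (hm : 0 <= m) by (unfold m; lra).
destruct (shift_exists g m hg hm) as [y [tau sh]].
assert (hcm : forall n, commutes g (gpow g n)) by (intros n; now apply commutes_pow).
assert (hj : exists j, (1 <= j <= c)%nat /\ 20 < Rabs (tau (gpow g j))).
{ apply NNPP; intros hn.
  (* Shifts at most 20 would move [y] by at most [20 + 10], placing [c + 1] distinct conjugates in a
     ball with [c] elements. *)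
  assert (h : (length (map (fun x => y^-1 ** (x ** y)) (map (gpow g) (seq 0 (S c)))) <= c)%nat).
  { apply (has_card_length_le _ _ _ hc).
    - apply FinFun.Injective_map_NoDup; [|now apply NoDup_powers].
      intros a b e; apply gmul_inj_l, gmul_inj_r in e; trivial.
    - intros x hx; apply in_map_iff in hx as [x' [<- hx]].
      apply in_map_iff in hx as [i [<- hi]]; apply in_seq in hi.
      assert (hli : l (gpow g i) <= m).
      { pose proof (l_pow_le hl g i); assert (INR i <= INR c) by (apply le_INR; lia).
        assert (INR i * l g <= INR c * l g) by (now apply Rmult_le_compat_r).
        unfold m; lra. }
      pose proof (sh_dist _ _ _ _ sh gone (gpow g i)) as h1.
      rewrite gone_l, (hl_one l hl) in h1.
      specialize (h1 ltac:(unfold commutes; now gsimp) (hcm i) hm hli).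
      change (ldist l y (gpow g i ** y) <= 30).
      pose proof (sh_le _ _ _ _ sh gone) as h2; rewrite (hl_one l hl) in h2.
      pose proof (Rabs_triang (tau gone) (- tau (gpow g i))) as h3.
      rewrite Rabs_Ropp in h3; unfold Rminus in h1.
      enough (Rabs (tau (gpow g i)) <= 20) by lra.
      destruct i as [|i]; [simpl; lra|].
      apply Rnot_lt_le; intros hlt; apply hn; exists (S i); split; [lia|trivial]. }
  rewrite !length_map, length_seq in h; lia. }
destruct hj as [j [hj1 hj2]].
assert (hdiv : exists i, (fact c = j * i)%nat).
{ assert (hd : forall n, (j <= n)%nat -> exists i, (fact n = j * i)%nat).
  { induction n as [|n IH]; intros h; [lia|].
    destruct (Nat.eq_dec j (S n)) as [->|]; [exists (fact n); reflexivity|].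
    destruct IH as [i hi]; [lia|]; exists (S n * i)%nat.
    change (fact (S n)) with (S n * fact n)%nat; rewrite hi; lia. }
  apply hd; lia. }
destruct hdiv as [i hi].
assert (hi0 : (1 <= i)%nat) by (pose proof (lt_O_fact c); nia).
assert (he : exists eps, (eps = 1 \/ eps = -1) /\ 20 < eps * tau (gpow g j)).
{ revert hj2; unfold Rabs; destruct Rcase_abs; intros; [exists (-1)|exists 1]; split; auto; lra. }
destruct he as [eps [he1 he2]].
exists y, tau, eps; split; [|split; trivial].
- destruct sh as [s1 s2 s3]; split; trivial.
  + intros h k c1 c2 l1 l2; apply s2; trivial; unfold m; lra.
  + intros h k c1 c2 l1 l2; apply s3; trivial; unfold m; lra.
- intros k hk; rewrite hi, <- Nat.mul_assoc, gpow_mul.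
  rewrite hi, <- Nat.mul_assoc in hk.
  assert (hlj : l (gpow g j) <= INR j * l g) by apply (l_pow_le hl).
  assert (hle : INR (i * k) * l (gpow g j) <= m).
  { pose proof (pos_INR (i * k)).
    assert (INR (i * k) * l (gpow g j) <= INR (i * k) * (INR j * l g)) by (now apply Rmult_le_compat_l).
    rewrite mult_INR in hk; unfold m; lra. }
  pose proof (shift_pow g m y tau eps (gpow g j) (i * k) sh hm he1 (hcm j) hle) as hp.
  assert (hik : INR k <= INR (i * k)) by (apply le_INR; nia).
  assert (INR (i * k) * 18 <= INR (i * k) * (eps * tau (gpow g j) - 2))
    by (apply Rmult_le_compat_l; [apply pos_INR|lra]).
  lra.
Qed.

Lemma linear_growth g : g <> gone -> exists P, (0 < P)%nat /\
  forall k, 18 * INR k <= l (gpow (gpow g P) k).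
Proof.
intros hg; destruct (shift_growth g hg) as [P [hP h]]; exists P; split; trivial.
intros k; rewrite <- gpow_mul.
assert (h0 : 0 <= INR (P * k) * l g) by (apply Rmult_le_pos; [apply pos_INR|now apply hl_ge0]).
destruct (h _ h0) as [y [tau [eps [sh [he hk]]]]].
specialize (hk k (Rle_refl _)); pose proof (sh_le _ _ _ _ sh (gpow g (P * k))) as hs.
apply Rabs_le_inv in hs; destruct he; subst; lra.
Qed.

(** Equality of left cosets of the cyclic group generated by [g]; natural exponents on both sides
    replace integer powers. *)
Definition same_coset g h h' := exists a b : nat, h ** gpow g a = h' ** gpow g b.

(** Finite index of the group generated by [g] in its centraliser. Powers of [gpow g P] bring the
    shift of every representative into one window of length [T + 2]; the representatives then send
    [y] to points within [T + 12] of each other, and properness bounds their number independently of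
    the list. *)
Lemma centralizer_finite g : g <> gone -> exists Q : nat, forall hs : list G, NoDup hs ->
  (forall h, In h hs -> commutes g h) ->
  (forall h h', In h hs -> In h' hs -> same_coset g h h' -> h = h') ->
  (length hs <= Q)%nat.
Proof.
intros hg; destruct (shift_growth g hg) as [P [hP hsh]].
set (T := l (gpow g P)).
destruct (ball_card hl (T + 12)) as [Q hQ]; exists Q; intros hs nd hcm hsep.
assert (hV : exists V, forall h, In h hs -> l h <= INR V).
{ clear; induction hs as [|h hs [V hV]]; [exists 0%nat; easy|].
  destruct (INR_above (l h)) as [n hn]; exists (n + V)%nat.
  rewrite plus_INR; pose proof (pos_INR n); pose proof (pos_INR V).
  intros h' [<-|hh]; [lra|specialize (hV h' hh); lra]. }
destruct hV as [V hV].
pose proof (hl_ge0 hl g) as hlg.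
(* The scale leaves room for [V + 1] further factors [gpow g P]. *)
set (m := INR V + INR (P * (V + 1)) * l g).
assert (hPV : forall k, (k <= V + 1)%nat -> INR V + INR (P * k) * l g <= m).
{ intros k hk; unfold m; apply Rplus_le_compat_l, Rmult_le_compat_r; trivial.
  apply le_INR; nia. }
assert (hPk : forall k, 0 <= INR (P * k) * l g)
  by (intros; apply Rmult_le_pos; [apply pos_INR|trivial]).
pose proof (pos_INR V) as hV0.
assert (hm : 0 <= m) by (specialize (hPk (V + 1)%nat); unfold m; lra).
destruct (hsh m hm) as [y [tau [eps [sh [he hk]]]]].
assert (hcp : forall n, commutes g (gpow g n)) by (intros n; now apply commutes_pow).
assert (htP : 18 <= eps * tau (gpow g P) <= T).
{ specialize (hk 1%nat); rewrite Nat.mul_1_r in hk; simpl INR in hk.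
  pose proof (hPV 1%nat ltac:(lia)) as h1; rewrite Nat.mul_1_r in h1.
  specialize (hk ltac:(lra)).
  pose proof (sh_le _ _ _ _ sh (gpow g P)) as h2; apply Rabs_le_inv in h2.
  unfold T; destruct he; subst; lra. }
assert (hlP : T <= m).
{ pose proof (l_pow_le hl g P); pose proof (hPV 1%nat ltac:(lia)) as h1.
  rewrite Nat.mul_1_r in h1; unfold T; lra. }
assert (hlh : forall h k, In h hs -> (k <= V + 1)%nat -> l (h ** gpow g (P * k)) <= m).
{ intros h k hh hkV; pose proof (hl_mul l hl h (gpow g (P * k))).
  pose proof (l_pow_le hl g (P * k)); specialize (hPV k hkV); specialize (hV h hh); lra. }
assert (hcc : forall h k, In h hs -> commutes g (h ** gpow g k))
  by (intros; apply commutes_mul; auto).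
assert (step : forall h k, In h hs -> (k <= V + 1)%nat ->
  16 <= eps * tau (h ** gpow g (P * S k)) - eps * tau (h ** gpow g (P * k)) <= T + 2).
{ intros h k hh hkV.
  pose proof (sh_mul _ _ _ _ sh (h ** gpow g (P * k)) (gpow g P) (hcc h _ hh) (hcp P)
    (hlh h k hh hkV) hlP) as h1.
  rewrite gmulA, <- gpow_add in h1.
  replace (P * k + P)%nat with (P * S k)%nat in h1 by lia.
  apply Rabs_le_inv in h1; destruct he; subst; lra. }
assert (h0 : forall h, In h hs -> - INR V <= eps * tau h <= INR V).
{ intros h hh; pose proof (sh_le _ _ _ _ sh h) as h1; apply Rabs_le_inv in h1.
  specialize (hV h hh); destruct he; subst; lra. }
assert (hlow : forall h k, In h hs -> (k <= V + 1)%nat ->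
  16 * INR k - INR V <= eps * tau (h ** gpow g (P * k))).
{ intros h k hh; induction k as [|k IH]; intros hkV.
  - rewrite Nat.mul_0_r; simpl; rewrite gmul1; specialize (h0 h hh); lra.
  - rewrite S_INR; specialize (IH ltac:(lia)); specialize (step h k hh ltac:(lia)); lra. }
(* The shift starts at or below [V], is at least [V] when [k = V + 1], and moves up by at most
   [T + 2] at a time, so it enters the window. *)
assert (hex : forall h, In h hs -> exists k, (k <= V + 1)%nat /\
  INR V <= eps * tau (h ** gpow g (P * k)) <= INR V + T + 2).
{ intros h hh.
  assert (hf : forall k, (k <= V + 1)%nat -> INR V <= eps * tau (h ** gpow g (P * k)) ->
    exists k', (k' <= V + 1)%nat /\ INR V <= eps * tau (h ** gpow g (P * k')) <= INR V + T + 2).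
  { induction k as [|k IH]; intros hkV hle.
    - exists 0%nat; split; trivial; split; trivial.
      rewrite Nat.mul_0_r; simpl; rewrite gmul1; specialize (h0 h hh); lra.
    - destruct (Rle_dec (INR V) (eps * tau (h ** gpow g (P * k)))) as [hc|hc].
      + apply IH; trivial; lia.
      + exists (S k); split; trivial; specialize (step h k hh ltac:(lia)); lra. }
  apply (hf (V + 1)%nat); [lia|].
  specialize (hlow h (V + 1)%nat hh ltac:(lia)); rewrite plus_INR in hlow; simpl in hlow; lra. }
destruct hs as [|h1 hs'] eqn:ehs; [simpl; lia|]; rewrite <- ehs in *.
assert (hin : In h1 hs) by (rewrite ehs; now left).
destruct (hex h1 hin) as [k1 [hk1 ht1]].
destruct hQ as [lQ [_ [<- hQ]]].
destruct (le_lt_dec (length hs) (length lQ)) as [|hlt]; trivial; exfalso.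
destruct (pigeonhole_cover
  (fun s h => exists k, h ** gpow g k = (h1 ** gpow g (P * k1)) ** y ** s ** y^-1) lQ hs nd)
  as [s [a [a' [_ [ha [ha' [hne [[i hi] [i' hi']]]]]]]]]; trivial.
- intros h hh; destruct (hex h hh) as [k [hkV ht]].
  exists (((h1 ** gpow g (P * k1)) ** y)^-1 ** ((h ** gpow g (P * k)) ** y)); split.
  + apply hQ; change (ldist l ((h1 ** gpow g (P * k1)) ** y) ((h ** gpow g (P * k)) ** y) <= T + 12).
    eapply Rle_trans; [apply (sh_dist _ _ _ _ sh); auto|].
    enough (Rabs (tau (h1 ** gpow g (P * k1)) - tau (h ** gpow g (P * k))) <= T + 2) by lra.
    apply Rabs_le; destruct he; subst eps; lra.
  + exists (P * k)%nat; now gsimp.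
- apply hne, hsep; trivial; exists i, i'; congruence.
Qed.

(** Finite index puts two different powers of [u] into one coset; torsion-freeness excludes the
    exponent 0. *)
Lemma centralizer_power g u : g <> gone -> u <> gone -> commutes g u ->
  exists c e : nat, (0 < c)%nat /\ (0 < e)%nat /\
    (gpow u c = gpow g e \/ gpow u c = gpow g^-1 e).
Proof.
intros hg hu hc; destruct (centralizer_finite g hg) as [Q hQ].
assert (h : exists i j, i <> j /\ same_coset g (gpow u i) (gpow u j)).
{ apply NNPP; intros hn.
  assert (h : (length (map (gpow u) (seq 0 (S Q))) <= Q)%nat).
  { apply hQ; [now apply NoDup_powers| |].
    - intros h hh; apply in_map_iff in hh as [i [<- _]]; now apply commutes_pow.
    - intros h h' hh hh' hs; apply in_map_iff in hh as [i [<- _]].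
      apply in_map_iff in hh' as [j [<- _]]; f_equal.
      apply NNPP; intros ne; apply hn; eauto. }
  rewrite length_map, length_seq in h; lia. }
assert (h' : exists i j, (i < j)%nat /\ same_coset g (gpow u i) (gpow u j)).
{ destruct h as [i [j [ne [a [b e]]]]].
  destruct (lt_eq_lt_dec i j) as [[hlt|]|hlt]; [exists i, j| easy |exists j, i]; split; trivial.
  - now exists a, b.
  - now exists b, a. }
destruct h' as [i [j [hij [a [b e]]]]].
replace j with (i + (j - i))%nat in e by lia.
rewrite gpow_add, gmulA in e; apply gmul_inj_l in e.
set (c := (j - i)%nat) in *.
destruct (lt_eq_lt_dec a b) as [[hab|hab]|hab].
- exists c, (b - a)%nat; repeat split; [lia|lia|right].
  rewrite gpow_inv; apply (gmul_inj_r (gpow g b)); rewrite <- e.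
  replace b with ((b - a) + a)%nat at 2 by lia.
  now rewrite gpow_add, gmulKl.
- exfalso; subst b; apply (gpow_neq1 u c tf hu); [lia|].
  apply (gmul_inj_r (gpow g a)); now rewrite gone_l.
- exists c, (a - b)%nat; repeat split; [lia|lia|left].
  apply (gmul_inj_r (gpow g b)); rewrite <- e, <- gpow_add; f_equal; lia.
Qed.

End Centralizers.

(** * Groups with a commensurated cyclic subgroup *)

Definition Zgroup : Group :=
  MkGroup Z Z.add 0%Z Z.opp Z.add_assoc Z.add_0_l Z.add_opp_diag_l.

Lemma group_iso_sym (G1 G2 : Group) : group_iso G1 G2 -> group_iso G2 G1.
Proof.
intros [f [h [h1 [h2 h3]]]]; exists h, f; repeat split; trivial.
intros x y; rewrite <- (h2 (h x ** h y)), h1, !h3; reflexivity.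
Qed.

Lemma group_iso_trans (G1 G2 G3 : Group) :
  group_iso G1 G2 -> group_iso G2 G3 -> group_iso G1 G3.
Proof.
intros [f [h [h1 [h2 h3]]]] [f' [h' [h1' [h2' h3']]]].
exists (fun x => f' (f x)), (fun x => h (h' x)); repeat split.
- intros; now rewrite h1, h1'.
- intros; now rewrite h2', h2.
- intros; now rewrite h3, h3'.
Qed.

(** * Homomorphisms to the integers *)

Section HomToZ.
Context {G : Group} (F : G -> Z) (hF : forall a b, F (a ** b) = (F a + F b)%Z).

Lemma Zhom_one : F gone = 0%Z.
Proof. pose proof (hF gone gone) as h; rewrite gone_l in h; lia. Qed.

Lemma Zhom_inv a : F a^-1 = (- F a)%Z.
Proof. pose proof (hF a a^-1) as h; rewrite gmulV, Zhom_one in h; lia. Qed.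

Lemma Zhom_pow a n : F (gpow a n) = (Z.of_nat n * F a)%Z.
Proof.
induction n as [|n IH]; simpl gpow; [rewrite Zhom_one; lia|].
rewrite hF, IH; lia.
Qed.

Lemma Zhom_multiple a (k : Z) : exists b, F b = (k * F a)%Z.
Proof.
destruct (Z.le_ge_cases 0 k) as [h|h].
- exists (gpow a (Z.to_nat k)); rewrite Zhom_pow, Z2Nat.id by lia; reflexivity.
- exists (gpow a^-1 (Z.to_nat (- k))); rewrite Zhom_pow, Zhom_inv, Z2Nat.id by lia; ring.
Qed.

(** By division with remainder the image consists of the multiples of its least positive value
    [F t]; dividing by [F t] makes the map bijective. *)
Lemma iso_Z_of_injective w : (0 < F w)%Z -> (forall a, F a = 0%Z -> a = gone) ->
  group_iso G Zgroup.
Proof.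
intros hw inj.
assert (hmin : exists t, (0 < F t)%Z /\ forall a, (0 < F a)%Z -> (F t <= F a)%Z).
{ apply NNPP; intros hn.
  assert (h : forall n a, (0 < F a)%Z -> (F a <= Z.of_nat n)%Z -> False).
  { induction n as [|n IH]; intros a h1 h2; [lia|].
    apply hn; exists a; split; trivial; intros b hb.
    apply Z.nlt_ge; intros hlt; apply (IH b); lia. }
  apply (h (Z.to_nat (F w)) w); lia. }
destruct hmin as [t [ht hmin]].
assert (hdiv : forall a, F a = (F a / F t * F t)%Z).
{ intros a; destruct (Zhom_multiple t (- (F a / F t))) as [b hb].
  pose proof (hF a b) as h; rewrite hb in h.
  pose proof (Z.mod_pos_bound (F a) (F t) ht).
  pose proof (Z.div_mod (F a) (F t) ltac:(lia)).
  destruct (Z.eq_dec (F (a ** b)) 0) as [e|e]; [lia|].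
  pose proof (hmin (a ** b)); lia. }
assert (hsurj : forall k : Z, exists a, (F a / F t)%Z = k).
{ intros k; destruct (Zhom_multiple t k) as [a ha]; exists a; rewrite ha.
  apply Z.div_mul; lia. }
set (f := fun a => (F a / F t)%Z : Zgroup).
assert (finj : forall a b, f a = f b -> a = b).
{ unfold f; intros a b e; apply gdiv_one, inj; rewrite hF, Zhom_inv.
  rewrite (hdiv a), (hdiv b), e; lia. }
exists f, (fun k => proj1_sig (constructive_indefinite_description _ (hsurj k))).
assert (hfh : forall k, f (proj1_sig (constructive_indefinite_description _ (hsurj k))) = k).
{ intros k; destruct constructive_indefinite_description as [a ha]; exact ha. }
repeat split; trivial.
- intros a b; unfold f; simpl; rewrite hF.
  rewrite (hdiv a) at 1; rewrite Z.div_add_l by lia; reflexivity.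
- intros a; apply finj, hfh.
Qed.
End HomToZ.

Lemma maximal_list {T} (Pr : list T -> Prop) Q :
  Pr nil -> (forall s, Pr s -> (length s <= Q)%nat) ->
  exists s, Pr s /\ forall s', Pr s' -> (length s' <= length s)%nat.
Proof.
intros h0 hQ; apply NNPP; intros hn.
assert (h : forall n, exists s, Pr s /\ (n <= length s)%nat).
{ induction n as [|n [s [hs hl]]]; [exists nil; split; trivial; simpl; lia|].
  apply NNPP; intros hn'; apply hn; exists s; split; trivial.
  intros s' hs'; apply Nat.nlt_ge; intros hlt; apply hn'; exists s'; split; trivial; lia. }
destruct (h (S Q)) as [s [hs hl]]; specialize (hQ s hs); lia.
Qed.

(** * Transfer to a central cyclic subgroup *)

Section Transfer.
Context {G : Group} (tf : torsion_free G) (w : G) (hw : w <> gone).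
Context (central : forall g, commutes w g).

(** Says that [g] is [s] times the integer power of [w] with exponent [z], written as a difference
    of naturals. *)
Definition coord (g s : G) (z : Z) :=
  exists a b : nat, g ** gpow w a = s ** gpow w b /\ z = (Z.of_nat b - Z.of_nat a)%Z.

Lemma coord_comp g s t y z : coord g s y -> coord s t z -> coord g t (y + z).
Proof.
intros [a [b [e ->]]] [c [d [e' ->]]]; exists (a + c)%nat, (d + b)%nat; split; [|lia].
rewrite !gpow_add, !gassoc, e, <- e', !gmulA; f_equal; apply gpow_comm.
Qed.

Lemma coord_sym g s z : coord g s z -> coord s g (- z).
Proof. intros [a [b [e ->]]]; exists b, a; split; [congruence|lia]. Qed.

Lemma coord_mulr g s c z : coord g s z -> coord (g ** c) (s ** c) z.
Proof.
intros [a [b [e ->]]]; exists a, b; split; trivial.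
assert (h : forall n, c ** gpow w n = gpow w n ** c).
{ intros n; apply commutes_pow, commutes_sym, central. }
now rewrite !gmulA, !h, !gassoc, e.
Qed.

Lemma coord_self g z : coord g g z -> z = 0%Z.
Proof.
intros [a [b [e ->]]]; apply gmul_inj_l, gpow_inj in e; trivial; lia.
Qed.

Lemma coord_uniq g s y z : coord g s y -> coord g s z -> y = z.
Proof.
intros h1 h2; pose proof (coord_comp _ _ _ _ _ h1 (coord_sym _ _ _ h2)) as h.
apply coord_self in h; lia.
Qed.

Lemma coord_pow g n : coord (g ** gpow w n) g (Z.of_nat n).
Proof. exists 0%nat, n; simpl; split; [now rewrite gmul1|lia]. Qed.

Lemma same_coset_coord g h : same_coset w g h <-> exists z, coord g h z.
Proof.
split; [intros [a [b e]]; exists (Z.of_nat b - Z.of_nat a)%Z, a, b; auto|].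
intros [z [a [b [e _]]]]; now exists a, b.
Qed.

Context (S : list G) (ndS : NoDup S).
Context (sepS : forall h h', In h S -> In h' S -> same_coset w h h' -> h = h').
Context (rep : G -> G) (zc : G -> Z).
Context (hrep : forall g, In (rep g) S /\ coord g (rep g) (zc g)).

(** The classical transfer to the group generated by [w], read off as an exponent; [S] represents
    its cosets. *)
Definition transfer (g : G) : Z := fold_right Z.add 0%Z (map (fun s => zc (s ** g)) S).

Lemma rep_eq g s z : In s S -> coord g s z -> rep g = s /\ zc g = z.
Proof.
intros hs hc; destruct (hrep g) as [h1 h2].
assert (e : rep g = s).
{ apply sepS; trivial; apply same_coset_coord; exists (- zc g + z)%Z.
  eapply coord_comp; [apply coord_sym|]; eauto. }
split; trivial; rewrite e in h2; eapply coord_uniq; eauto.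
Qed.

Lemma sum_split {A} (f g : A -> Z) (s : list A) :
  fold_right Z.add 0%Z (map (fun x => f x + g x)%Z s) =
  (fold_right Z.add 0%Z (map f s) + fold_right Z.add 0%Z (map g s))%Z.
Proof. induction s as [|x s IH]; simpl; [|rewrite IH]; lia. Qed.

Lemma sum_perm (s t : list Z) : Permutation s t ->
  fold_right Z.add 0%Z s = fold_right Z.add 0%Z t.
Proof. induction 1; simpl; lia. Qed.

(** The exponents form a cocycle. Right multiplication by [a] permutes the cosets, so the second sum
    is [transfer b] in another order. *)
Lemma transfer_mul a b : transfer (a ** b) = (transfer a + transfer b)%Z.
Proof.
unfold transfer.
rewrite (map_ext_in _ (fun s => zc (s ** a) + zc (rep (s ** a) ** b))%Z).
2:{ intros s hs; destruct (hrep (s ** a)) as [h1 h2].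
    destruct (hrep (rep (s ** a) ** b)) as [h3 h4].
    eapply rep_eq; [exact h3|].
    rewrite gassoc; eapply coord_comp; [apply coord_mulr; exact h2|exact h4]. }
rewrite sum_split; f_equal.
rewrite <- (map_map (fun s => rep (s ** a)) (fun r => zc (r ** b))).
apply sum_perm, Permutation_map, NoDup_Permutation_bis.
- assert (hinj : forall s s', In s S -> In s' S -> rep (s ** a) = rep (s' ** a) -> s = s').
  { intros s s' hs hs' e; apply sepS; trivial; apply same_coset_coord.
    destruct (hrep (s ** a)) as [_ h1]; destruct (hrep (s' ** a)) as [_ h2].
    rewrite e in h1; pose proof (coord_comp _ _ _ _ _ h1 (coord_sym _ _ _ h2)) as h.
    apply (coord_mulr _ _ a^-1) in h; rewrite !gmulA, gmulV, !gmul1 in h; eauto. }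
  clear - ndS hinj; induction S as [|x q IH]; simpl; [constructor|].
  inversion ndS as [|? ? hx nd]; subst; constructor.
  + intros hin; apply in_map_iff in hin as [y [e hy]]; apply hx.
    rewrite <- (hinj y x); trivial; [now right|now left].
  + apply IH; trivial; intros; apply hinj; trivial; now right.
- rewrite length_map; lia.
- intros x hx; apply in_map_iff in hx as [y [<- _]]; apply hrep.
Qed.

Lemma transfer_gen : transfer w = Z.of_nat (length S).
Proof.
unfold transfer; rewrite (map_ext_in _ (fun _ => 1%Z)).
- clear; induction S as [|x q IH]; trivial.
  cbn [map fold_right length]; rewrite IH; lia.
- intros s hs; apply (rep_eq (s ** w) s 1%Z hs).
  pose proof (coord_pow s 1) as h; simpl in h; now rewrite gmul1 in h.
Qed.

End Transfer.

(** The centraliser of [w] is the whole group, so a longest list of inequivalent elements represents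
    all cosets. The transfer is injective: a nontrivial element has a power equal to a nontrivial
    power of [w], whose transfer is a nonzero multiple of the index. *)
Lemma iso_Z_of_central_power {G : Group} (l : G -> R) (w : G) :
  hyp_length l -> torsion_free G -> w <> gone -> (forall g, commutes w g) ->
  group_iso G Zgroup.
Proof.
intros hl tf hw hc; destruct (centralizer_finite hl tf w hw) as [Q hQ].
destruct (maximal_list (fun s => NoDup s /\
  forall h h', In h s -> In h' s -> same_coset w h h' -> h = h') Q)
  as [S [[nd sep] hmax]].
- split; [constructor|easy].
- intros s [nd sep]; apply hQ; auto.
- assert (hr : forall g, exists p : G * Z, In (fst p) S /\ coord w g (fst p) (snd p)).
  { intros g; apply NNPP; intros hn.
    assert (hg : forall s, In s S -> ~ same_coset w g s).
    { intros s hs hsc; apply same_coset_coord in hsc as [z hz]; apply hn.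
      now exists (s, z). }
    assert (refl : forall x, same_coset w x x) by (intros x; now exists 0%nat, 0%nat).
    specialize (hmax (g :: S)); simpl in hmax.
    enough (Datatypes.S (length S) <= length S)%nat by lia.
    apply hmax; split.
    - constructor; trivial; intros hin; exact (hg g hin (refl g)).
    - intros h h' [<-|hh] [<-|hh'] hsc; trivial; [now apply hg in hsc| |now apply sep].
      exfalso; apply (hg h hh); destruct hsc as [a [b e]]; now exists b, a. }
  set (p := fun g => proj1_sig (constructive_indefinite_description _ (hr g))).
  assert (hp : forall g, In (fst (p g)) S /\ coord w g (fst (p g)) (snd (p g))).
  { intros g; unfold p; destruct constructive_indefinite_description as [q hq]; exact hq. }
  set (F := transfer S (fun g => snd (p g))).
  assert (hF : forall a b, F (a ** b) = (F a + F b)%Z).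
  { exact (transfer_mul tf w hw hc S nd sep (fun g => fst (p g)) (fun g => snd (p g)) hp). }
  assert (hFw : F w = Z.of_nat (length S)).
  { exact (transfer_gen tf w hw S sep (fun g => fst (p g)) (fun g => snd (p g)) hp). }
  assert (hS : (0 < length S)%nat).
  { destruct (hp gone) as [h _]; destruct S; [easy|simpl; lia]. }
  apply (iso_Z_of_injective F hF w); [lia|].
  intros a ha; apply NNPP; intros ne.
  destruct (centralizer_power hl tf w a hw ne (hc a)) as [c [e [h1 [h2 h3]]]].
  assert (h4 : F (gpow a c) = 0%Z) by (rewrite Zhom_pow; trivial; lia).
  destruct h3 as [h3|h3]; rewrite h3, Zhom_pow, ?Zhom_inv, hFw in h4; trivial; nia.
Qed.

(** * Elements commensurating a cyclic subgroup *)

Section Commensurator.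
Context {G : Group} {l : G -> R} (hl : hyp_length l) (tf : torsion_free G).
Implicit Types z h u v w : G.

(** If [n1 < n2], iterating the third hypothesis [j] times and using the linear bounds would make
    the [j]-th power of [n2 / n1] grow at most linearly in [j]. *)
Lemma growth_exponents (b : nat -> R) (n1 n2 : nat) (C : R) :
  (forall k, 18 * INR k <= b k) -> (forall k, b k <= INR k * b 1%nat) ->
  (forall k, b (n2 * k)%nat <= b (n1 * k)%nat + C) -> (0 < n1)%nat -> 0 <= C ->
  (n2 <= n1)%nat.
Proof.
intros h1 h2 h3 hn1 hC; apply Nat.nlt_ge; intros hlt.
assert (hit : forall j k, b (n2 ^ j * k)%nat <= b (n1 ^ j * k)%nat + INR j * C).
{ induction j as [|j IH]; intros k; [simpl; lra|].
  rewrite S_INR; cbn [Nat.pow].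
  specialize (h3 (n2 ^ j * k)%nat); specialize (IH (n1 * k)%nat).
  replace (n2 * n2 ^ j * k)%nat with (n2 * (n2 ^ j * k))%nat by lia.
  replace (n1 * n1 ^ j * k)%nat with (n1 ^ j * (n1 * k))%nat by lia.
  replace (n1 * (n2 ^ j * k))%nat with (n2 ^ j * (n1 * k))%nat in h3 by lia.
  lra. }
assert (hx1 : 1 <= INR n1) by (apply (le_INR 1); lia).
set (eta := / INR n1).
assert (heta : 0 < eta) by (apply Rinv_0_lt_compat; lra).
assert (hx : INR n1 * (1 + eta) <= INR n2).
{ unfold eta; rewrite Rmult_plus_distr_l, Rinv_r, Rmult_1_r by lra.
  rewrite <- S_INR; apply le_INR; lia. }
assert (hb1 : 0 <= b 1%nat) by (specialize (h1 1%nat); simpl in h1; lra).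
assert (hj : forall j, 18 * (1 + eta) ^ j <= b 1%nat + INR j * C).
{ intros j; specialize (hit j 1%nat); rewrite !Nat.mul_1_r in hit.
  specialize (h1 (n2 ^ j)%nat); specialize (h2 (n1 ^ j)%nat); rewrite pow_INR in h1, h2.
  assert (hp : (INR n1 * (1 + eta)) ^ j <= INR n2 ^ j) by (apply pow_incr; split; [nra|trivial]).
  rewrite Rpow_mult_distr in hp.
  assert (hp1 : 1 <= INR n1 ^ j) by now apply pow_R1_Rle.
  assert (0 <= INR j * C) by (apply Rmult_le_pos; [apply pos_INR|trivial]).
  apply (Rmult_le_reg_l (INR n1 ^ j)); nra. }
(* For [j = 2 * i], Bernoulli's inequality makes the left side quadratic in [i]; beyond the
   threshold [X] it exceeds the linear right side. *)
set (X := (b 1%nat + 2 * C) / (18 * (eta * eta))).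
assert (hee : 0 < eta * eta) by now apply Rmult_lt_0_compat.
destruct (INR_above (X + 1)) as [i hi].
assert (hX : X * (18 * (eta * eta)) = b 1%nat + 2 * C) by (unfold X; field; lra).
assert (hX0 : 0 <= X) by (apply Rmult_le_pos; [lra|left; apply Rinv_0_lt_compat; lra]).
specialize (hj (2 * i)%nat); rewrite pow_mult, mult_INR in hj; simpl INR in hj.
assert (hpi : 1 + INR i * eta <= (1 + eta) ^ i) by now apply poly.
rewrite <- pow_mult, Nat.mul_comm, pow_mult in hj.
assert (hsq : (1 + INR i * eta) ^ 2 <= ((1 + eta) ^ i) ^ 2).
{ apply pow_incr; split; trivial.
  assert (0 <= INR i * eta) by (apply Rmult_le_pos; lra); lra. }
assert (h4 : 18 * (INR i * INR i * (eta * eta)) < b 1%nat + 2 * INR i * C).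
{ assert (0 <= INR i * eta) by (apply Rmult_le_pos; lra); nra. }
assert (h5 : INR i * (b 1%nat + 2 * C) <= INR i * (INR i * (18 * (eta * eta)))).
{ apply Rmult_le_compat_l; [lra|]; rewrite <- hX; apply Rmult_le_compat_r; lra. }
assert (b 1%nat <= INR i * b 1%nat) by nra.
nra.
Qed.

(** A Baumslag-Solitar relation with unequal exponents contradicts linear growth of the powers of
    [z], since conjugation by [h] changes lengths by at most [2 * l h]. *)
Lemma conj_exponents z zu zv h (n1 n2 : nat) : z <> gone ->
  (zu = z \/ zu = z^-1) -> (zv = z \/ zv = z^-1) -> (0 < n1)%nat -> (0 < n2)%nat ->
  h ** gpow zv n1 = gpow zu n2 ** h -> n1 = n2.
Proof.
intros hz hu hv hn1 hn2 e.
destruct (linear_growth hl tf z hz) as [P [hP hg]].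
set (b := fun k => l (gpow (gpow z P) k)).
assert (hb : forall x k, (x = z \/ x = z^-1) -> l (gpow x (P * k)) = b k).
{ intros x k [->| ->]; unfold b; rewrite <- gpow_mul; trivial.
  now rewrite gpow_inv, hl_inv. }
assert (hb1 : forall k, b k <= INR k * b 1%nat).
{ intros k; unfold b; pose proof (l_pow_le hl (gpow z P) k) as h1; simpl; now rewrite gmul1. }
assert (hc : forall k, h ** gpow zv (P * (n1 * k)) = gpow zu (P * (n2 * k)) ** h).
{ intros k; apply (gpow_conj _ _ _ (P * k)) in e; rewrite <- !gpow_mul in e.
  replace (P * (n1 * k))%nat with (n1 * (P * k))%nat by lia.
  now replace (P * (n2 * k))%nat with (n2 * (P * k))%nat by lia. }
pose proof (hl_ge0 hl h) as h0.
apply Nat.le_antisymm.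
- apply (growth_exponents b n2 n1 (2 * l h)); trivial; [|lra].
  intros k; rewrite <- (hb zv (n1 * k)%nat hv), <- (hb zu (n2 * k)%nat hu).
  replace (gpow zv (P * (n1 * k))) with (h^-1 ** (gpow zu (P * (n2 * k)) ** h))
    by (rewrite <- hc; now gsimp).
  eapply Rle_trans; [apply (hl_mul l hl)|]; rewrite (hl_inv l hl).
  pose proof (hl_mul l hl (gpow zu (P * (n2 * k))) h); lra.
- apply (growth_exponents b n1 n2 (2 * l h)); trivial; [|lra].
  intros k; rewrite <- (hb zu (n2 * k)%nat hu), <- (hb zv (n1 * k)%nat hv).
  replace (gpow zu (P * (n2 * k))) with (h ** (gpow zv (P * (n1 * k)) ** h^-1))
    by (rewrite gassoc, hc; now gsimp).
  eapply Rle_trans; [apply (hl_mul l hl)|].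
  pose proof (hl_mul l hl (gpow zv (P * (n1 * k))) h^-1) as h1.
  rewrite (hl_inv l hl) in h1; lra.
Qed.

(** [h ** h] commutes with [w], so one of its powers is a nontrivial power of [w] or its inverse. It
    commutes with [h], yet [h] inverts it, which produces torsion. *)
Lemma not_inverted w h : w <> gone -> h ** w = w^-1 ** h -> False.
Proof.
intros hw e.
assert (sq : forall e0 : nat, (0 < e0)%nat -> gpow w e0 = gpow w^-1 e0 -> False).
{ intros n hn h1; apply (gpow_neq1 w (n + n) tf hw); [lia|].
  rewrite gpow_add; rewrite h1 at 1; now rewrite gpow_inv, ginv_l. }
assert (e' : h ** w^-1 = w ** h).
{ apply (gmul_inj_l w^-1), (gmul_inj_r w); gsimp; now rewrite e. }
assert (hh : h <> gone).
{ intros ->; rewrite gone_l, gmul1 in e; apply (sq 1%nat); [lia|]; simpl; now rewrite !gmul1. }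
assert (hh2 : h ** h <> gone).
{ intros h2; apply hh, (tf h 2%nat); [lia|]; simpl; now rewrite gmul1. }
assert (hc : commutes w (h ** h)).
{ unfold commutes; now rewrite (gmulA h h w), e, (gassoc _ h w^-1 h), e', gmulA. }
destruct (centralizer_power hl tf w (h ** h) hw hh2 hc) as [c [n [h1 [h2 h3]]]].
assert (hcc : h ** gpow (h ** h) c = gpow (h ** h) c ** h).
{ apply commutes_pow; unfold commutes; now gsimp. }
pose proof (gpow_conj _ _ _ n e) as f1; pose proof (gpow_conj _ _ _ n e') as f2.
apply (sq n); trivial.
destruct h3 as [h3|h3]; rewrite h3 in hcc.
- rewrite hcc in f1; now apply gmul_inj_r in f1.
- rewrite hcc in f2; symmetry; now apply gmul_inj_r in f2.
Qed.

(** Suitable powers of [u] and [v] are powers of [z] up to sign, so a power of the relation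
    conjugates powers of [z]. [conj_exponents] equates the exponents, [not_inverted] the signs. *)
Lemma commutes_with_power z h u v : z <> gone -> u <> gone -> v <> gone ->
  commutes z u -> commutes z v -> h ** v = u ** h ->
  exists m, (0 < m)%nat /\ commutes (gpow z m) h.
Proof.
intros hz hu hv cu cv e.
assert (hpow : forall x, x <> gone -> commutes z x -> exists y (c n : nat),
  (y = z \/ y = z^-1) /\ (0 < c)%nat /\ (0 < n)%nat /\ gpow x c = gpow y n).
{ intros x hx cx; destruct (centralizer_power hl tf z x hz hx cx) as [c [n [h1 [h2 [h3|h3]]]]].
  - exists z, c, n; auto.
  - exists z^-1, c, n; auto. }
destruct (hpow u hu cu) as [zu [c [n [su [c1 [n1 eu]]]]]].
destruct (hpow v hv cv) as [zv [c' [n' [sv [c1' [n1' ev]]]]]].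
apply (gpow_conj _ _ _ (c * c')) in e.
rewrite (gpow_mul u), eu, (Nat.mul_comm c c'), (gpow_mul v), ev, <- !gpow_mul in e.
assert (en : (n' * c = n * c')%nat) by (apply (conj_exponents z zu zv h); trivial; nia).
rewrite en in e; exists (n * c')%nat; split; [nia|].
set (m := (n * c')%nat) in *.
assert (hm : (0 < m)%nat) by (unfold m; nia).
assert (hzm : gpow z m <> gone) by now apply gpow_neq1.
destruct su as [->| ->], sv as [->| ->]; rewrite ?gpow_inv in e.
- symmetry; exact e.
- exfalso; apply (not_inverted (gpow z m)^-1 h); [|now rewrite ginvK].
  intros h1; apply hzm; rewrite <- (ginvK (gpow z m)), h1; apply ginv1.
- exfalso; exact (not_inverted _ _ hzm e).
- apply commutes_sym; rewrite <- (ginvK (gpow z m)); now apply commutes_inv.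
Qed.

(** The product of the exponents over the finite ball of radius 10 serves all its elements; the ball
    generates, so this power of [z] is central. *)
Lemma iso_Z_of_commensurator z : z <> gone ->
  (forall h, l h <= 10 -> exists u v, u <> gone /\ v <> gone /\
     commutes z u /\ commutes z v /\ h ** v = u ** h) ->
  group_iso G Zgroup.
Proof.
intros hz hcomm.
assert (hm : exists m, (0 < m)%nat /\ forall h, l h <= 10 -> commutes (gpow z m) h).
{ destruct (ball_card hl 10) as [n [s [_ [_ hs]]]].
  assert (hm : exists m, (0 < m)%nat /\ forall h, In h s -> commutes (gpow z m) h).
  { assert (hs' : forall h, In h s -> l h <= 10) by (intros; now apply hs).
    clear hs; induction s as [|h s IH]; [exists 1%nat; split; [lia|easy]|].
    destruct IH as [m [hm1 hm2]]; [intros; apply hs'; now right|].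
    destruct (hcomm h (hs' h (or_introl eq_refl))) as [u [v [h1 [h2 [h3 [h4 h5]]]]]].
    destruct (commutes_with_power z h u v) as [m' [hm1' hm2']]; trivial.
    exists (m * m')%nat; split; [nia|]; intros h' [<-|hh].
    - rewrite Nat.mul_comm, gpow_mul; apply commutes_sym, commutes_pow, commutes_sym, hm2'.
    - rewrite gpow_mul; apply commutes_sym, commutes_pow, commutes_sym; auto. }
  destruct hm as [m [h1 h2]]; exists m; split; trivial; intros h hh; apply h2, hs, hh. }
destruct hm as [m [hm1 hm2]].
apply (iso_Z_of_central_power l (gpow z m)); trivial.
- now apply gpow_neq1.
- apply (ball_ind hl); trivial.
  intros x s hx hs; apply commutes_mul; auto.
Qed.

End Commensurator.

(** * Counting the groups *)

Lemma has_card_ext {T} (P Q : T -> Prop) n :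
  (forall x, P x <-> Q x) -> has_card P n -> has_card Q n.
Proof.
intros h [s [h1 [h2 h3]]]; exists s; repeat split; trivial; intros; [apply h, h3|apply h3, h]; trivial.
Qed.

(** * Nilpotent subgroups of torsion-free groups *)

Section Nilpotent.
Context {G : Group} (tf : torsion_free G).

Lemma finite_subgroup_trivial (L : G -> Prop) :
  subgroup L -> finite_set L -> forall x, L x -> x = gone.
Proof.
intros [h1 [h2 _]] [s hs] x hx; apply NNPP; intros ne.
assert (hp : forall n, L (gpow x n)) by (induction n; simpl; auto).
pose proof (@NoDup_incl_length _ _ s (NoDup_powers tf x (S (length s)) ne)) as h.
rewrite length_map, length_seq in h.
enough (S (length s) <= length s)%nat by lia.
apply h; intros y hy; apply in_map_iff in hy as [i [<- _]]; auto.
Qed.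

(** The element is taken from the last nontrivial term of the lower central series: its commutators
    with [G0] lie in the next term, which is trivial. *)
Lemma nilpotent_centralized (G0 L : G -> Prop) :
  nilpotent_mod G0 L -> (forall x, L x -> x = gone) -> (exists x, G0 x /\ x <> gone) ->
  exists z, z <> gone /\ forall u, G0 u -> commutes z u.
Proof.
intros [c hc] hL hx.
assert (hc' : forall x, lcs G0 c x -> x = gone) by auto.
clear hc hL; induction c as [|c IH].
- destruct hx as [x [h1 h2]]; elim h2; now apply hc'.
- destruct (classic (forall x, lcs G0 c x -> x = gone)) as [h|h]; [auto|].
  apply not_all_ex_not in h as [z hz]; apply imply_to_and in hz as [hz hz1].
  exists z; split; trivial; intros u hu.
  assert (h : comm z u = gone) by (apply hc'; simpl; apply gen_base; eauto).
  unfold comm in h; apply gdiv_one in h.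
  unfold commutes; rewrite h at 2; now gsimp.
Qed.
End Nilpotent.

(** Covering a one-element subset of the integers already needs a translate. *)
Lemma BGT_pos (nu : R -> nat) K : BGT_function nu -> 1 <= K -> (1 <= nu K)%nat.
Proof.
intros [_ [c hc]] hK.
assert (h1 : has_card (fun x : Zgroup => x = gone) 1).
{ exists (gone :: nil); repeat split; trivial.
  - constructor; [easy|constructor].
  - intros [<-|[]]; trivial.
  - intros ->; now left. }
assert (h2 : has_card (prodset (fun x : Zgroup => x = gone) (fun x => x = gone)) 1).
{ apply (has_card_ext (fun x : Zgroup => x = gone)); trivial; intros x; split.
  - intros ->; exists gone, gone; repeat split.
  - intros [a [b [-> [-> ->]]]]; reflexivity. }
destruct (hc K hK Zgroup _ _ 1%nat 1%nat 1%nat h1 h1 ltac:(lia) ltac:(lia) h2)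
  as [G0 [L [_ [_ [_ [_ [_ [ts [hl hts]]]]]]]]].
{ simpl; rewrite sqrt_1; lra. }
destruct (hts gone eq_refl) as [t [ht _]].
destruct ts; [easy|simpl in hl; lia].
Qed.

(* If a coset of [G0] contains more than [nu K] elements of the ball of radius 10, then right
   multiplying them by any [h] in that ball and covering again puts two of them in one coset,
   so [G0] meets its conjugate by [h]. *)
Lemma ball_card_or_Z (nu : R -> nat) {G : Group} (l : G -> R) (H K : R) :
  BGT_function nu -> hyp_length l -> torsion_free G -> growth_le l H -> 0 < H ->
  243 * exp (800 * H) <= K ->
  group_iso G Zgroup \/
  exists s, NoDup s /\ (forall g, In g s <-> l g <= 10) /\ (length s <= nu K * nu K)%nat.
Proof.
intros hnu hl tf hgr hH hKle.
assert (he : 1 <= exp (800 * H)) by (rewrite <- exp_0; apply exp_le_mono; lra).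
assert (hK : 1 <= K) by lra.
destruct (ball_card hl 120) as [n1 hn1]; destruct (ball_card hl 240) as [n2 hn2].
pose proof (ball_doubling H n1 n2 hl hgr hH hn2 hn1) as hdb.
set (A := fun g => l g <= 120) in *.
assert (hAA : forall x, prodset A A x -> l x <= 240).
{ intros x [a [b [ha [hb ->]]]]; unfold A in *; pose proof (hl_mul l hl a b); lra. }
destruct (has_card_of_finite (prodset A A)) as [nAA hnAA].
{ destruct (hl_proper l hl 240) as [q hq]; exists q; auto. }
assert (hle : (nAA <= n2)%nat) by (apply (has_card_sub _ _ _ _ hnAA hn2 hAA)).
assert (h1 : A gone) by (unfold A; rewrite (hl_one l hl); lra).
assert (hn1p : (0 < n1)%nat).
{ destruct hn1 as [q [_ [<- hq]]]; apply hq in h1; destruct q; [easy|simpl; lia]. }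
destruct hnu as [_ [c hc]].
destruct (hc K hK G A A n1 n1 nAA hn1 hn1 hn1p hn1p hnAA)
  as [G0 [L [hG0 [hL [hLf [hnil [_ [ts [hts hcov]]]]]]]]].
{ rewrite Rmult_assoc, sqrt_def by apply pos_INR.
  apply le_INR in hle; eapply Rle_trans; [exact hle|].
  eapply Rle_trans; [exact hdb|]; apply Rmult_le_compat_r; [apply pos_INR|trivial]. }
assert (hL1 : forall x, L x -> x = gone).
{ apply finite_subgroup_trivial; trivial; apply hL. }
destruct hG0 as [g1 [g2 g3]].
destruct (ball_card hl 10) as [n [s [nds [_ hs]]]].
set (Rel := fun t a => G0 (t^-1 ** a)).
destruct (classic (forall t s', In t ts -> NoDup s' ->
  (forall a, In a s' -> In a s /\ Rel t a) -> (length s' <= length ts)%nat)) as [hsm|hbig].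
- right; exists s; repeat split; trivial; [apply hs|apply hs|].
  eapply Nat.le_trans; [apply (length_cover Rel (length ts) ts s); trivial|nia].
  intros a ha; apply hcov; apply hs in ha; unfold A; lra.
- left.
  apply not_all_ex_not in hbig as [t hbig]; apply not_all_ex_not in hbig as [s' hbig].
  assert (hb : NoDup s' /\ (forall a, In a s' -> In a s /\ Rel t a) /\ (length ts < length s')%nat).
  { apply NNPP; intros hn; apply hbig; intros _ a1 a2; apply Nat.nlt_ge; intros a3; tauto. }
  destruct hb as [nd' [hs' hlt]].
  destruct s' as [|e0 s1] eqn:es; [simpl in hlt; lia|]; rewrite <- es in *.
  assert (he0 : In e0 s') by (rewrite es; now left).
  assert (hdiff : forall a b, In a s' -> In b s' -> G0 (a^-1 ** b)).
  { intros a b ha hb; apply hs' in ha as [_ ha]; apply hs' in hb as [_ hb]; unfold Rel in *.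
    replace (a^-1 ** b) with ((t^-1 ** a)^-1 ** (t^-1 ** b)) by now gsimp.
    auto. }
  assert (hl10 : forall a, In a s' -> l a <= 10) by (intros a ha; apply hs, hs', ha).
  assert (hconj : forall h, l h <= 10 ->
    exists u v, u <> gone /\ v <> gone /\ G0 u /\ G0 v /\ h ** v = u ** h).
  { intros h hh.
    (* The translates [e0^-1 ** a ** h] have length at most 30, so the cover of the ball of radius
       120 reaches them, and there are more of them than cosets. *)
    destruct (pigeonhole_cover (fun t a => Rel t (e0^-1 ** a ** h)) ts s' nd')
      as [t' [a [b [_ [ha [hb [ne [ra rb]]]]]]]]; trivial.
    { intros a ha; apply hcov; unfold A.
      pose proof (hl_mul l hl (e0^-1 ** a) h); pose proof (hl_mul l hl e0^-1 a) as h2.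
      rewrite (hl_inv l hl) in h2; pose proof (hl10 a ha); pose proof (hl10 e0 he0); lra. }
    exists (a^-1 ** b), (h^-1 ** (a^-1 ** b) ** h); unfold Rel in ra, rb.
    assert (hu : a^-1 ** b <> gone) by (intros e; apply ne, gdiv_one, e).
    split; [trivial|split; [|split; [now apply hdiff|split; [|now gsimp]]]].
    - intros e; apply hu.
      replace (a^-1 ** b) with (h ** (h^-1 ** (a^-1 ** b) ** h) ** h^-1) by now gsimp.
      rewrite e; now gsimp.
    - replace (h^-1 ** (a^-1 ** b) ** h)
        with ((t'^-1 ** (e0^-1 ** a ** h))^-1 ** (t'^-1 ** (e0^-1 ** b ** h))) by now gsimp.
      auto. }
  destruct (nilpotent_centralized G0 L hnil hL1) as [z [hz hzc]].
  { destruct (hconj gone) as [u [_ [h2 [_ [h3 _]]]]]; [rewrite (hl_one l hl); lra|eauto]. }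
  apply (iso_Z_of_commensurator hl tf z hz).
  intros h hh; destruct (hconj h hh) as [u [v [a1 [a2 [a3 [a4 a5]]]]]].
  exists u, v; auto 10.
Qed.

(** * From actions on hyperbolic spaces to length functions *)

Section FromSpace.
Context {X : Type} (d : X -> X -> R) (delta : R).
Context (met : is_metric d) (geo : geodesic_space d) (thin : thin_triangles d delta).

Lemma thin_insize (w x y : X) (s1 s3 : R -> X) (t : R) :
  geod_seg d w x s1 -> geod_seg d y w s3 -> 0 <= t <= gprod d w x y ->
  d (s1 t) (s3 (d y w - t)) <= delta.
Proof.
intros h1 h3 ht; destruct (geo x y) as [s2 h2].
now apply (thin w x y s1 s2 s3 h1 h2 h3).
Qed.

(** With [m] the smaller of the two Gromov products with [z] at [w], the points at distance [m] from
    [w] on the sides to [x] and [y] are both within [delta] of the one on the side to [z]. The path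
    from [x] to [y] through these points gives the bound. *)
Lemma four_points (x w y z : X) :
  d x y + d w z <= Rmax (d x w + d y z) (d w y + d x z) + 2 * delta.
Proof.
destruct met as [m0 [_ [ms mt]]].
enough (h : forall m, 0 <= m -> m <= gprod d w x z -> m <= gprod d w y z ->
  d x y <= d w x - m + (2 * delta + (d w y - m))).
{ set (m := Rmin (gprod d w x z) (gprod d w y z)).
  assert (hm0 : 0 <= m).
  { apply Rmin_glb; unfold gprod.
    - pose proof (mt x w z) as h1; rewrite (ms x w) in h1; lra.
    - pose proof (mt y w z) as h1; rewrite (ms y w) in h1; lra. }
  specialize (h m hm0 (Rmin_l _ _) (Rmin_r _ _)).
  pose proof (Rmax_l (d x w + d y z) (d w y + d x z)).
  pose proof (Rmax_r (d x w + d y z) (d w y + d x z)).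
  rewrite (ms x w) in *.
  unfold m, gprod in h; revert h; apply Rmin_case; lra. }
intros m hm0 hm1 hm2.
destruct (geo w x) as [s1 h1]; destruct (geo w y) as [s2 h2]; destruct (geo z w) as [s3 h3].
pose proof (thin_insize w x z s1 s3 m h1 h3 (conj hm0 hm1)) as a1.
pose proof (thin_insize w y z s2 s3 m h2 h3 (conj hm0 hm2)) as a2.
assert (hx : m <= d w x).
{ unfold gprod in hm1; pose proof (mt w x z); lra. }
assert (hy : m <= d w y).
{ unfold gprod in hm2; pose proof (mt w y z); lra. }
assert (b1 : d (s1 m) x = d w x - m).
{ destruct h1 as [_ [e1 h1]]; rewrite <- e1 at 1; rewrite h1 by lra.
  rewrite Rabs_left1; lra. }
assert (b2 : d (s2 m) y = d w y - m).
{ destruct h2 as [_ [e2 h2]]; rewrite <- e2 at 1; rewrite h2 by lra.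
  rewrite Rabs_left1; lra. }
pose proof (mt x (s1 m) y); pose proof (mt (s1 m) (s2 m) y).
pose proof (mt (s1 m) (s3 (d z w - m)) (s2 m)) as a3.
rewrite (ms (s3 _) (s2 m)) in a3; rewrite (ms x (s1 m)) in *; lra.
Qed.
End FromSpace.

(** The length is the displacement of the base point of the entropy, divided by [D + delta]; this
    rescaling multiplies the entropy by [D + delta]. *)
Lemma length_of_action (G : Group) {X : Type} (d : X -> X -> R) (act : G -> X -> X)
    (delta H D : R) :
  0 < delta -> 0 < D -> hyperbolic_space d delta -> isom_action G d act ->
  proper_action G d act -> entropy_le G d act H -> quotient_diam_le G d act D ->
  exists l : G -> R, hyp_length l /\ growth_le l (H * (D + delta)).
Proof.
intros hd hD [met [_ [geo thin]]] [act1 [actM actd]] hprop [x hent] hdiam.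
set (E := D + delta).
assert (hE : 0 < E) by (unfold E; lra).
assert (hEi : 0 < / E) by now apply Rinv_0_lt_compat.
pose (l := fun g : G => d x (act g x) / E).
assert (ld : forall a b : G, ldist l a b = d (act a x) (act b x) / E).
{ intros a b; unfold ldist, l; f_equal.
  now rewrite <- (actd a), <- actM, gmulVKl. }
pose proof met as [m0 [m1 [ms mt]]].
assert (hlE : forall u v, u / E <= v <-> u <= v * E).
{ intros u v; split; intros h.
  - replace u with (u / E * E) by (field; lra); apply Rmult_le_compat_r; lra.
  - replace v with (v * E / E) by (field; lra); apply Rmult_le_compat_r; lra. }
exists l; split; [split|].
- unfold l; rewrite act1, (proj2 (m1 x x)) by trivial; lra.
- intros a; unfold l; f_equal; rewrite <- (actd a), <- actM, gmulV, act1; apply ms.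
- intros a b; unfold l; rewrite <- Rdiv_plus_distr; apply Rmult_le_compat_r; [lra|].
  rewrite actM, <- (actd a x (act b x)); apply mt.
- intros r; destruct (hprop x (r * E)) as [q hq]; exists q; intros g hg; apply hq.
  now apply hlE.
- intros a b c e; rewrite !ld.
  pose proof (four_points d delta met geo thin (act a x) (act b x) (act c x) (act e x)) as h.
  rewrite <- !Rdiv_plus_distr; apply hlE.
  assert (hmx : forall u v, Rmax u v <= Rmax (u / E) (v / E) * E).
  { intros u v; apply Rmax_lub; apply hlE; [apply Rmax_l|apply Rmax_r]. }
  specialize (hmx (d (act a x) (act b x) + d (act c x) (act e x))
                  (d (act b x) (act c x) + d (act a x) (act e x))).
  rewrite Rmult_plus_distr_r; unfold E in *; lra.
- intros a b s; rewrite ld; intros [hs0 hs1].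
  set (L := d (act a x) (act b x)) in *.
  assert (hsL : s * E <= L).
  { replace L with (L / E * E) by (field; lra); apply Rmult_le_compat_r; lra. }
  assert (hs : 0 <= s * E) by (apply Rmult_le_pos; lra).
  destruct (geo (act a x) (act b x)) as [gam [g1 [g2 g3]]]; fold L in g2, g3.
  (* The slack [E] in the quotient diameter yields an orbit point within [D + E <= 2 * E]. *)
  destruct (hdiam (gam (s * E)) x E hE) as [c hc].
  exists c; rewrite !ld; split; apply hlE.
  + pose proof (mt (act a x) (gam (s * E)) (act c x)) as h1.
    rewrite <- g1 in h1 at 2; rewrite g3, Rabs_left1 in h1 by lra.
    unfold E in *; lra.
  + pose proof (mt (act c x) (gam (s * E)) (act b x)) as h1.
    rewrite <- g2 in h1 at 2; rewrite g3, Rabs_left1, (ms (act c x) (gam _)) in h1 by lra.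
    replace ((L / E - s + 2) * E) with (L - s * E + 2 * E) by (field; lra).
    unfold E in *; lra.
- intros eps heps R0.
  destruct (hent (eps / E) ltac:(apply Rdiv_lt_0_compat; lra) (R0 * E)) as [Rr [n [h1 [h2 [h3 h4]]]]].
  exists (Rr / E), n; repeat split.
  + replace R0 with (R0 * E / E) by (field; lra); apply Rmult_le_compat_r; lra.
  + apply Rdiv_lt_0_compat; lra.
  + apply (has_card_ext (fun g => d x (act g x) < Rr)); trivial; intros g; unfold l; split; intros h.
    * apply Rmult_lt_compat_r; lra.
    * apply (Rmult_lt_reg_r (/ E)); trivial.
  + replace (ln (INR n) / (Rr / E)) with (ln (INR n) / Rr * E) by (field; lra).
    replace (H * E + eps) with ((H + eps / E) * E) by (field; lra).
    apply Rmult_le_compat_r; lra.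
Qed.

(** Unrelated elements cannot share a code, so the code used by the head can be removed before the
    induction continues. *)
Lemma length_le_codes {A B} (Rel : A -> A -> Prop) (C : A -> B -> Prop) (s : list A) (codes : list B) :
  ForallOrdPairs (fun a b => ~ Rel a b) s ->
  (forall a b c, C a c -> C b c -> Rel a b) ->
  (forall a, In a s -> exists c, In c codes /\ C a c) -> (length s <= length codes)%nat.
Proof.
intros hp hC; revert codes; induction hp as [|a s ha hp IH]; intros codes hs; [simpl; lia|].
destruct (hs a (or_introl eq_refl)) as [c [hc hac]].
apply in_split in hc as [c1 [c2 ->]].
rewrite length_app; simpl; enough (length s <= length (c1 ++ c2))%nat by (rewrite length_app in *; lia).
apply IH; intros b hb; destruct (hs b (or_intror hb)) as [c' [hc' hbc']].
exists c'; split; trivial; rewrite in_app_iff in *; destruct hc' as [h|[->|h]]; auto.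
rewrite Forall_forall in ha; elim (ha b hb); eauto.
Qed.

(** * Boolean codes and final estimates *)

Fixpoint bool_lists (n : nat) : list (list bool) :=
  match n with
  | O => nil :: nil
  | S n => nil :: map (cons true) (bool_lists n) ++ map (cons false) (bool_lists n)
  end.

(** The successor leaves room for one more code, later given to the infinite cyclic group. *)
Lemma length_bool_lists n : S (length (bool_lists n)) = (2 ^ S n)%nat.
Proof.
induction n as [|n IH]; trivial.
cbn [bool_lists length]; rewrite length_app, !length_map.
change (2 ^ S (S n))%nat with (2 * 2 ^ S n)%nat; lia.
Qed.

Lemma in_bool_lists n s : (length s <= n)%nat -> In s (bool_lists n).
Proof.
revert s; induction n as [|n IH]; intros [|b s] h; simpl in h; try lia; try now left.
right; apply in_app_iff; destruct b; [left|right]; apply in_map, IH; lia.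
Qed.

Definition has_table (G : Group) (c : list bool) : Prop :=
  exists (l : G -> R) (s : list G), hyp_length l /\ NoDup s /\
    (forall g, In g s <-> l g <= 10) /\ mult_table s = c.

(** A group is coded by [None] when it is isomorphic to the integers, and otherwise by the table of
    its ball of radius 10, of length at most [M * M * M]. *)
Lemma class_count (nu : R -> nat) (delta H D K : R) (ls : list Group) :
  BGT_function nu -> 0 < delta -> 0 < H -> 0 < D ->
  243 * exp (800 * (H * (D + delta))) <= K ->
  (forall G, In G ls -> in_class_H delta H D G) ->
  ForallOrdPairs (fun G1 G2 => ~ group_iso G1 G2) ls ->
  (length ls <= 2 ^ S (nu K * nu K * (nu K * nu K) * (nu K * nu K)))%nat.
Proof.
intros hnu hd hH hD hK hls hp; set (M := (nu K * nu K)%nat).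
rewrite <- length_bool_lists.
replace (S (length (bool_lists (M * M * M))))
  with (length (None :: map Some (bool_lists (M * M * M)))) by (simpl; now rewrite length_map).
apply (length_le_codes group_iso
  (fun G o => match o with None => group_iso G Zgroup | Some c => has_table G c end)); trivial.
- intros G1 G2 [c|] h1 h2.
  + destruct h1 as [l1 [s1 [a1 [a2 [a3 a4]]]]]; destruct h2 as [l2 [s2 [b1 [b2 [b3 b4]]]]].
    apply (mult_table_iso s1 s2 l1 l2); trivial; congruence.
  + eapply group_iso_trans; [exact h1|now apply group_iso_sym].
- intros G hG; destruct (hls G hG) as [tf [X [d [act [h1 [h2 [h3 [h4 h5]]]]]]]].
  destruct (length_of_action G d act delta H D hd hD h1 h2 h3 h4 h5) as [l [hl hgr]].
  assert (hHE : 0 < H * (D + delta)) by (apply Rmult_lt_0_compat; lra).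
  destruct (ball_card_or_Z nu l _ K hnu hl tf hgr hHE hK) as [hZ|[s [s1 [s2 s3]]]].
  + exists None; split; [now left|trivial].
  + exists (Some (mult_table s)); split; [|now exists l, s].
    right; apply in_map, in_bool_lists; rewrite length_mult_table.
    fold M in s3; assert (length s * length s <= M * M)%nat by nia; nia.
Qed.

(** The last term of the sum suffices: its index [i] is at least [M + 1], its inner exponent at
    least 4, and [(M + 1) ^ 4 >= M ^ 3 + 1]. *)
Lemma N1_ge (nu : R -> nat) (delta H : R) (M : nat) :
  0 < delta -> INR M + 3 <= Nfun nu delta H 1 ->
  INR (2 ^ S (M * M * M)) <= N1 nu delta H.
Proof.
intros hd hM; unfold N1.
set (i := nat_floor (Nfun nu delta H 1)).
assert (hi : INR M + 1 <= INR i).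
{ unfold i, nat_floor; destruct (base_Int_part (Nfun nu delta H 1)) as [h1 h2].
  set (z := Int_part _) in *.
  assert (hz : (Z.of_nat M + 2 <= z)%Z).
  { enough (Z.of_nat M + 1 < z)%Z by lia; apply lt_IZR; rewrite plus_IZR, <- INR_IZR_INZ; lra. }
  rewrite (INR_IZR_INZ (Z.to_nat z)), Z2Nat.id, (INR_IZR_INZ M) by lia.
  rewrite <- plus_IZR; apply IZR_le; lia. }
set (f := fun j => Rpower 2 (rpow (2 * INR j) (4 * delta + 6))).
assert (hf : f i <= sum_f_R0 f i).
{ destruct i as [|j]; [simpl; lra|]; rewrite tech5.
  assert (0 <= sum_f_R0 f j) by (apply cond_pos_sum; intros; left; apply exp_pos); lra. }
eapply Rle_trans; [|exact hf]; unfold f.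
pose proof (pos_INR M) as hM0.
rewrite pow_INR; replace (INR 2) with 2 by (simpl; lra).
rewrite <- Rpower_pow by lra; apply Rle_Rpower; [lra|].
unfold rpow; destruct Rle_dec as [|hn]; [lra|].
apply Rle_trans with (Rpower (2 * INR i) (INR 4)).
- rewrite Rpower_pow by lra; rewrite S_INR, !mult_INR.
  assert (h2 : (INR M + 1) ^ 4 <= (2 * INR i) ^ 4) by (apply pow_incr; lra).
  assert (0 <= INR M * INR M) by now apply Rmult_le_pos.
  assert (0 <= INR M * INR M * INR M) by now apply Rmult_le_pos.
  assert (0 <= INR M * INR M * (INR M * INR M)) by now apply Rmult_le_pos.
  nra.
- apply Rle_Rpower; [lra|simpl; lra].
Qed.

(** Since [nu] is nondecreasing and the fraction is at least 1, the value is at least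
    [nu K * (nu K + 3)]; then [nu K >= 1] gives the claim. *)
Lemma Nfun_ge (nu : R -> nat) (delta H : R) : BGT_function nu -> 0 < delta -> 0 < H ->
  let K := 243 * exp (72 * H * (1 + delta)) in
  INR (nu K * nu K) + 3 <= Nfun nu delta H 1.
Proof.
intros hnu hd hH K; unfold Nfun; fold K.
set (K' := 243 * exp (73 * H * (1 + 4 * delta))).
assert (h0 : 0 <= 72 * H * (1 + delta)) by (repeat apply Rmult_le_pos; lra).
assert (hK : 1 <= K).
{ unfold K; apply exp_le_mono in h0; rewrite exp_0 in h0; lra. }
assert (hKK : K <= K').
{ apply Rmult_le_compat_l; [lra|]; apply exp_le_mono; nra. }
assert (h1 : INR (nu K) <= INR (nu K')) by (apply le_INR, hnu; lra).
assert (h2 : 1 <= INR (nu K)) by (apply (le_INR 1), BGT_pos; trivial).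
assert (h3 : 1 <= 20 * (1 + delta) / (5 * 1 + delta)).
{ apply (Rmult_le_reg_r (5 * 1 + delta)); [lra|].
  replace (20 * (1 + delta) / (5 * 1 + delta) * (5 * 1 + delta)) with (20 * (1 + delta))
    by (field; lra); lra. }
set (q := 20 * (1 + delta) / (5 * 1 + delta)) in *; rewrite mult_INR.
assert (h4 : INR (nu K) + 2 <= q * (INR (nu K') + 2)) by nra.
nra.
Qed.

Theorem mainTheorem12 (nu : R -> nat) (delta H D : R) :
  BGT_function nu -> 0 < delta -> 0 < H -> 0 < D ->
  forall l : list Group,
    (forall G, In G l -> in_class_H delta H D G) ->
    ForallOrdPairs (fun G1 G2 => ~ group_iso G1 G2) l ->
    INR (length l) <= N2 nu delta H D.
Proof.
intros hnu hd hH hD l hl hp.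
assert (hdD : 0 < delta / D) by now apply Rdiv_lt_0_compat.
assert (hHD : 0 < H * D) by now apply Rmult_lt_0_compat.
assert (hHd : 0 < H * delta) by now apply Rmult_lt_0_compat.
set (delta' := 16 * (delta / D + 2)); set (H' := 10 * H * D).
assert (hd' : 0 < delta') by (unfold delta'; lra).
assert (hH' : 0 < H') by (unfold H'; lra).
pose proof (Nfun_ge nu delta' H' hnu hd' hH') as hN; cbv zeta in hN.
set (K := 243 * exp (72 * H' * (1 + delta'))) in *.
eapply Rle_trans; [|apply (N1_ge nu delta' H' _ hd' hN)].
apply le_INR, (class_count nu delta H D); trivial.
unfold K; apply Rmult_le_compat_l; [lra|]; apply exp_le_mono.
(* Both coefficients exceed 800, the constant in the doubling exponent. *)
replace (72 * H' * (1 + delta')) with (23760 * (H * D) + 11520 * (H * delta))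
  by (unfold H', delta'; field; lra).
lra.
Qed.
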